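(* Let $(\boldsymbol{\nu},\mathbf{G},T)$ be an instance of (stochastic) Rising Graph-Triggered Bandits with $k$ arms and general connectivity matrix $\mathbf{G}\in\{0,1\}^{k\times k}$, and let $\bar{\mathbf{G}}^U$ be the minimal block super-matrix of $\mathbf{G}$, with clique partition $\mathcal{C}_{\bar{\mathbf{G}}^U}$. Let $h_{i,t}=\lfloor\epsilon N_{i,t-1}\rfloor$ for $\epsilon\in(0,1/2)$ and $\delta_t=t^{-\alpha}$ for $\alpha>2$. Then the algorithm R-$\square$-UCB suffers an expected regret bounded by $$R_{\boldsymbol{\nu},\mathbf{G},T}(\text{R-}\square\text{-UCB})\le\widetilde{\mathcal{O}}\Bigg(\min_{q\in[0,1]}\Bigg\{(\sigma T)^{\frac23}+T^q\,\bar k_1\,\Upsilon_{\boldsymbol{\nu}}\Big(\Big\lceil\tfrac{T}{\bar k_1}\Big\rceil,q\Big)+T^{\frac{2q}{1+q}}\sum_{C_m^U\in\mathcal{C}_{\bar{\mathbf{G}}^U}}|C_m^U|\,\Upsilon_{\boldsymbol{\nu}}\Big(\Big\lceil\tfrac{T}{|C_m^U|}\Big\rceil,q\Big)^{\frac1{1+q}}\Bigg\}\Bigg),$$ where $\bar k_1$ is the number of arms $i$ of degree $1$, i.e. with $\sum_{j\in[k]}\mathbf{G}_{j,i}=1$ (the second term is taken to be $0$ when $\bar k_1=0$).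
   Context: Graph-Triggered Bandits (GTB): there are $k$ arms, a horizon $T\in\mathbb{N}$, and a symmetric connectivity matrix $\mathbf{G}\in\{0,1\}^{k\times k}$ with $\mathbf{G}_{i,i}=1$ for all $i\in[k]$. At each round $t\in[T]$ the agent selects an arm $I_t$ based on the past history. Let $N_{i,t}=\sum_{\tau\le t}\mathbf{1}\{I_\tau=i\}$ (pulls) and $\widetilde N_{i,t}=\sum_{\tau\le t}\mathbf{1}\{\mathbf{G}_{I_\tau,i}=1\}$ (triggers). The agent observes a reward $X_{I_t,t}$ drawn from $\nu_{I_t,n}$ with $n=\widetilde N_{I_t,t}$, with mean $\mu_{I_t}(n)\in[0,1]$; the centered rewards are $\sigma^2$-subgaussian. Performance: $J_{\boldsymbol{\nu},\mathbf{G},T}(\pi)=\mathbb{E}[\sum_{t=1}^T\mu_{I_t}(\widetilde N_{I_t,t})]$; expected regret: $R_{\boldsymbol{\nu},\mathbf{G},T}(\pi)=\sup_{\pi'}J_{\boldsymbol{\nu},\mathbf{G},T}(\pi')-J_{\boldsymbol{\nu},\mathbf{G},T}(\pi)$. Rising: with $\gamma_i(n)=\mu_i(n+1)-\mu_i(n)$, for all $i,n$: $\gamma_i(n)\ge0$ and $\gamma_i(n-1)\ge\gamma_i(n)$. Total increment: $\Upsilon_{\boldsymbol{\nu}}(M,q)=\sum_{t=1}^{M-1}\max_{i\in[k]}\gamma_i(t)^q$. A matrix $\mathbf{H}\in\{0,1\}^{k\times k}$ is block-diagonal if there is a partition $\mathcal{C}_{\mathbf{H}}$ of $[k]$ (its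 cliques) such that $\mathbf{H}_{i,j}=1$ iff $i,j$ are in the same class. A block-diagonal $\mathbf{G}^U$ is a block super-matrix of $\mathbf{G}$ if $\mathbf{G}_{i,j}-\mathbf{G}^U_{i,j}\le0$ for all $i,j$; it is minimal if it maximizes the number of cliques $|\mathcal{C}_{\mathbf{G}^U}|$ among all block super-matrices of $\mathbf{G}$. Algorithm R-$\square$-UCB (inputs $\sigma$, $(\delta_t)_{t\in[T]}$, $\epsilon$; it does not know $\mathbf{G}$): at each round $t$ play $I_t\in\arg\max_{i\in[k]}\{\widehat\mu_i^{h_{i,t}}(t)+\beta_i^{h_{i,t}}(t,\delta_t)\}$ (ties arbitrary), where $h_{i,t}=\lfloor\epsilon N_{i,t-1}\rfloor$, $t_{i,l}$ is the round of the $l$-th pull of arm $i$, and for $h\ge1$ $$\widehat\mu_i^h(t)=\frac1h\sum_{l=N_{i,t-1}-h+1}^{N_{i,t-1}}\Big(X_{i,t_{i,l}}+(t-l)\frac{X_{i,t_{i,l}}-X_{i,t_{i,l-h}}}{h}\Big),\qquad \beta_i^h(t,\delta)=\sigma\,(t-N_{i,t-1}+h-1)\sqrt{\frac{10\log(1/\delta)}{h^3}},$$ while the index is $+\infty$ when $h_{i,t}=0$. Notation $f\le\widetilde{\mathcal{O}}(g)$: there are a constant $c$ depending only on $k,\epsilon,\alpha$ and a universal $p\geq 0$ such that $f\le c\,(1+\log T)^p\,(1+g)$. *)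

(* Defs.v *)
From HB Require Import structures.
From mathcomp Require Import all_boot all_order all_algebra.
From mathcomp Require Import all_classical all_reals all_analysis.
From mathcomp Require Import measurable_realfun.

Set Implicit Arguments.
Unset Strict Implicit.
Unset Printing Implicit Defensive.

Import Order.TTheory GRing.Theory Num.Theory.
Import numFieldNormedType.Exports.

Local Open Scope classical_set_scope.
Local Open Scope ring_scope.

(* Measurable types of the library are pointed, so there are k.+1 arms, k : nat;
   they carry the discrete sigma-algebra. *)
HB.instance Definition _ (k : nat) := isPointed.Build 'I_k.+1 ord0.
HB.instance Definition _ (k : nat) :=
  @isMeasurable.Build default_measure_display 'I_k.+1
    (@discrete_measurable 'I_k.+1) (@discrete_measurable0 _)
    (@discrete_measurableC _) (@discrete_measurableU _).

(* What the agent sees in one round: the arm played and the reward received. *)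
Notation obs R k := ('I_k.+1 * measurableTypeR R)%type.

Section Histories.
Context {R : realType} {k : nat}.
Implicit Types (h : seq (obs R k)) (s : seq 'I_k.+1) (i : 'I_k.+1).

Definition arms h : seq 'I_k.+1 := [seq z.1 | z <- h].

Definition pulls i s : nat := count_mem i s.

Definition triggers (G : 'M[bool]_k.+1) i s : nat := count (fun j => G j i) s.

(* Reward of the l-th pull of arm i, l >= 1. *)
Definition pull_reward h i (l : nat) : R :=
  nth 0 [seq (z.2 : R) | z <- h & z.1 == i] l.-1.

End Histories.

(* [nu i n] is the reward law of arm i at its n-th trigger; only n >= 1 is
   meaningful, and hypotheses on [nu] are restricted accordingly. *)
Definition environment (R : realType) (k : nat) : Type :=
  'I_k.+1 -> nat -> probability (measurableTypeR R) R.

(* [pol t] draws the arm of round t + 1 from the history of the first t rounds. *)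
Definition policy (R : realType) (k : nat) : Type :=
  forall t : nat, R.-pker (t.-tuple (obs R k)) ~> 'I_k.+1.

Section Measurability.
Context {R : realType} {k : nat}.

Lemma measurable_finite_range d d' (T : measurableType d)
    (T' : measurableType d') (I : finType) (f : T -> I) (g : I -> T') :
  (forall i, measurable (f @^-1` [set i])) ->
  measurable_fun [set: T] (g \o f).
Proof.
move=> mf _ B _; rewrite setTI.
have -> : (g \o f) @^-1` B = \bigcup_(i in [set i | B (g i)]) (f @^-1` [set i]).
  by apply/seteqP; split=> [x Bx|x [i Bi /= ->]] //; exists (f x).
by apply: fin_bigcup_measurable => // ; exact: finite_finset.
Qed.

Definition arms_tuple t (h : t.-tuple (obs R k)) : t.-tuple 'I_k.+1 :=
  [tuple of [seq z.1 | z <- h]].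

Lemma measurable_arms t (s : t.-tuple 'I_k.+1) :
  measurable (@arms_tuple t @^-1` [set s]).
Proof.
have -> : @arms_tuple t @^-1` [set s] = \bigcap_(j in [set: 'I_t])
    ((fun h : t.-tuple (obs R k) => tnth h j) @^-1` (fst @^-1` [set tnth s j])).
  apply/seteqP; split=> [h /= <- j _ /=|h /= H]; first by rewrite tnth_map.
  by apply: eq_from_tnth => j; rewrite tnth_map; exact: H.
apply: fin_bigcap_measurable => [|j _]; first exact: finite_finset.
have m1 : measurable ((fst : obs R k -> 'I_k.+1) @^-1` [set tnth s j]).
  rewrite -[X in measurable X]setTI.
  exact: (@measurable_fst _ _ 'I_k.+1 (measurableTypeR R)).
by rewrite -[X in measurable X]setTI; exact: measurable_tnth.
Qed.

Lemma measurable_rcons t :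
  measurable_fun [set: (t.-tuple (obs R k) * 'I_k.+1) * measurableTypeR R]
    (fun z => [tuple of rcons z.1.1 (z.1.2, z.2)]
              : t.+1.-tuple (obs R k)).
Proof.
apply/measurable_fun_tnthP => j /=.
case: (ltnP j t) => [jt|tj].
  rewrite [X in measurable_fun _ X](_ : _ =
      (fun h : t.-tuple (obs R k) => tnth h (Ordinal jt)) \o (fst \o fst)).
    apply: measurableT_comp; first exact: measurable_tnth.
    exact: measurableT_comp.
  apply/funext => -[[h i] x] /=.
  by rewrite !(tnth_nth (i, x)) /= nth_rcons size_tuple jt.
rewrite [X in measurable_fun _ X](_ : _ = fun z => (z.1.2, z.2)).
  apply: measurable_fun_pair; last exact: measurable_snd.
  exact: measurableT_comp.
apply/funext => -[[h i] x] /=.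
have ejt : nat_of_ord j = t by apply/eqP; rewrite eqn_leq tj -ltnS ltn_ord.
by rewrite (tnth_nth (i, x)) /= nth_rcons size_tuple ejt ltnn eqxx.
Qed.

End Measurability.

Section Interaction.
Context {R : realType} {k : nat}.
Variables (nu : environment R k) (G : 'M[bool]_k.+1) (pol : policy R k).

(* Reward of the next round, given the past and the arm i just chosen: its law
   is nu i n, n counting the triggers of i with the current round included. *)
Definition reward_kernel t (z : t.-tuple (obs R k) * 'I_k.+1)
    : {measure set (measurableTypeR R) -> \bar R} :=
  nu z.2 (triggers G z.2 (rcons (arms z.1) z.2)).

Let measurable_reward t U : measurable U ->
  measurable_fun [set: t.-tuple (obs R k) * 'I_k.+1] (@reward_kernel t ^~ U).
Proof.
move=> _.
pose f (z : t.-tuple (obs R k) * 'I_k.+1) := (arms_tuple z.1, z.2).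
pose g (y : t.-tuple 'I_k.+1 * 'I_k.+1) := nu y.2 (triggers G y.2 (rcons y.1 y.2)) U.
rewrite [X in measurable_fun _ X](_ : _ = g \o f)//.
apply: measurable_finite_range => -[s i].
rewrite (_ : _ @^-1` _ = (@arms_tuple R k t @^-1` [set s]) `*` [set i]).
  by apply: measurableX => //; exact: measurable_arms.
by apply/seteqP; split=> [[h j] [] /= <- <-|[h j] [/= <- <-]].
Qed.

HB.instance Definition _ t := isKernel.Build _ _ _ _ R
  (@reward_kernel t) (@measurable_reward t).

Let reward_prob t z : @reward_kernel t z [set: _] = 1%E.
Proof. exact: probability_setT. Qed.

HB.instance Definition _ t := Kernel_isProbability.Build _ _ _ _ R
  (@reward_kernel t) (@reward_prob t).

(* One round: pick an arm, draw its reward, append the pair to the history. *)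
Definition round_kernel t
    : t.-tuple (obs R k) -> {measure set (t.+1.-tuple (obs R k)) -> \bar R} :=
  (pol t \; (@reward_kernel t \; kdirac (@measurable_rcons R k t)))%E.

HB.instance Definition _ t := SFiniteKernel.on (@round_kernel t).

Lemma round_kernelE t h (U : set (t.+1.-tuple (obs R k))) :
  (round_kernel h U =
   \int[pol t h]_i \int[reward_kernel (h, i)]_x
     \d_([tuple of rcons h (i, x)] : t.+1.-tuple (obs R k)) U)%E.
Proof. by []. Qed.

Lemma round_kernelT t (h : t.-tuple (obs R k)) : round_kernel h [set: _] = 1%E.
Proof.
rewrite round_kernelE (eq_integral (cst 1%E)) => [|i _].
  by rewrite integral_cst// mul1e prob_kernel.
rewrite (eq_integral (cst 1%E)) => [|x _]; last by rewrite diracT.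
by rewrite integral_cst// mul1e prob_kernel.
Qed.

Section Extend.
Context (t : nat) (P : probability (t.-tuple (obs R k)) R).

Definition extend (U : set (t.+1.-tuple (obs R k))) : \bar R :=
  (\int[P]_h round_kernel h U)%E.

Let extend0 : extend set0 = 0%E.
Proof. by rewrite /extend integral0_eq// => h _; rewrite measure0. Qed.

Let extend_ge0 U : (0 <= extend U)%E.
Proof. by apply: integral_ge0 => h _; exact: measure_ge0. Qed.

Let extend_sigma_additive : semi_sigma_additive extend.
Proof.
move=> U mU tU mUU; rewrite [X in _ --> X](_ : _ =
  \int[P]_h (\sum_(n <oo) round_kernel h (U n)))%E; last first.
  apply: eq_integral => h _.
  by apply/esym/cvg_lim => //; exact/measure_semi_sigma_additive.
apply/cvg_closeP; split.
  by apply: is_cvg_nneseries => n _ _; exact: integral_ge0.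
rewrite closeE// integral_nneseries// => n.
exact: measurable_kernel.
Qed.

HB.instance Definition _ := isMeasure.Build _ _ _ extend
  extend0 extend_ge0 extend_sigma_additive.

Let extendT : extend [set: _] = 1%E.
Proof.
rewrite /extend (eq_integral (cst 1%E)) => [|h _]; last exact: round_kernelT.
by rewrite integral_cst// mul1e; exact: probability_setT.
Qed.

HB.instance Definition _ := Measure_isProbability.Build _ _ _ extend extendT.

Definition extend_prob : probability (t.+1.-tuple (obs R k)) R := extend.

End Extend.

(* Law of the first t rounds of the interaction of [pol] with [nu] and [G]. *)
Fixpoint trajectory_law t : probability (t.-tuple (obs R k)) R :=
  if t is t'.+1 then extend_prob (trajectory_law t')
  else dirac ([tuple] : 0.-tuple (obs R k)).

End Interaction.

Section Performance.
Context {R : realType} {k : nat}.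
Variables (nu : environment R k) (G : 'M[bool]_k.+1) (T : nat).

Definition mean (i : 'I_k.+1) (n : nat) : R := fine 'E_(nu i n)[fun x => x].

(* The t-th entry of a trajectory (counting from 0) is round t + 1. *)
Definition total_mean (w : T.-tuple (obs R k)) : R :=
  \sum_(t < T)
    let i := (tnth w t).1 in mean i (triggers G i (take t.+1 (arms w))).

Definition performance (pol : policy R k) : \bar R :=
  'E_(trajectory_law nu G pol T)[total_mean].

Definition regret (pol : policy R k) : \bar R :=
  (ereal_sup [set performance pol' | pol' in [set: policy R k]]
   - performance pol)%E.

End Performance.

Section Instances.
Context {R : realType} {k : nat}.
Implicit Types (nu : environment R k) (G : 'M[bool]_k.+1).

Definition connectivity G : Prop :=
  (forall i j, G i j = G j i) /\ (forall i, G i i).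

Definition means_in_unit nu : Prop :=
  forall i n, (0 < n)%N -> 0 <= mean nu i n <= 1.

Definition subgaussian (sigma : R) nu : Prop :=
  forall i n, (0 < n)%N -> forall lambda : R,
    ('M_(nu i n) (fun x => x - mean nu i n)%R lambda
       <= (expR (lambda ^+ 2 * sigma ^+ 2 / 2))%:E)%E.

Definition gamma nu i n : R := mean nu i n.+1 - mean nu i n.

Definition rising nu : Prop :=
  (forall i n, (0 < n)%N -> 0 <= gamma nu i n) /\
  (forall i n, (1 < n)%N -> gamma nu i n <= gamma nu i n.-1).

(* At q = 0 the library's convention is 0 `^ 0 = 1. *)
Definition Upsilon nu (M : nat) (q : R) : R :=
  \sum_(1 <= t < M) \big[Num.max/0]_(i < k.+1) gamma nu i t `^ q.

Definition degree G (i : 'I_k.+1) : nat := \sum_(j < k.+1) G j i.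

Definition num_isolated G : nat := #|[pred i | degree G i == 1%N]|.

Definition block_diagonal (H : 'M[bool]_k.+1) (C : {set {set 'I_k.+1}}) : Prop :=
  finset.partition C [set: 'I_k.+1]%SET /\
  forall i j, H i j = [exists B in C, (i \in B) && (j \in B)].

Definition block_supermatrix G (GU : 'M[bool]_k.+1) (C : {set {set 'I_k.+1}}) : Prop :=
  block_diagonal GU C /\ forall i j, (G i j <= GU i j)%N.

Definition minimal_block_supermatrix G GU C : Prop :=
  block_supermatrix G GU C /\
  forall GU' C', block_supermatrix G GU' C' -> (#|C'| <= #|C|)%N.

End Instances.

Section Algorithm.
Context {R : realType} {k : nat}.
Variables (sigma : R) (delta : nat -> R) (eps : R).
Implicit Types (h : seq (obs R k)) (i : 'I_k.+1) (w : nat).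

(* In all the following, [h] is the history before the current round. *)
Definition round h : nat := (size h).+1.

Definition window h i : nat := Num.truncn (eps * (pulls i (arms h))%:R).

(* Since eps < 1/2, the subtraction l - w below is never truncated when
   w is the window of i. *)
Definition mu_hat h i w : R :=
  let N := pulls i (arms h) in
  w%:R^-1 * \sum_((N - w).+1 <= l < N.+1)
    (pull_reward h i l
     + ((round h)%:R - l%:R)
       * ((pull_reward h i l - pull_reward h i (l - w)) / w%:R)).

Definition beta h i w : R :=
  sigma * ((round h)%:R - (pulls i (arms h))%:R + w%:R - 1)
  * Num.sqrt (10 * ln (1 / delta (round h)) / w%:R ^+ 3).

Definition ucb_index h i : \bar R :=
  let w := window h i in
  if w == 0%N then +oo%E else (mu_hat h i w + beta h i w)%:E.

(* The arm played is almost surely an index maximiser; ties may be broken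
   arbitrarily, possibly at random and depending on the history. *)
Definition R_square_UCB (T : nat) (pol : policy R k) : Prop :=
  forall t (h : t.-tuple (obs R k)), (t < T)%N ->
    pol t h [set i | forall j, (ucb_index h j <= ucb_index h i)%E] = 1%E.

End Algorithm.

Section Bound.
Context {R : realType} {k : nat}.
Variables (nu : environment R k) (G : 'M[bool]_k.+1) (C : {set {set 'I_k.+1}}).
Variables (sigma : R) (T : nat).

Definition ceil_div (a b : nat) : nat := `|Num.ceil (a%:R / b%:R : R)|%N.

Definition rate (q : R) : R :=
  let k1 := num_isolated G in
  (sigma * T%:R) `^ (2 / 3)
  + T%:R `^ q * k1%:R * Upsilon nu (ceil_div T k1) q
  + T%:R `^ (2 * q / (1 + q))
    * \sum_(B in C) #|B|%:R * Upsilon nu (ceil_div T #|B|) q `^ (1 / (1 + q)).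

(* With an infimum the bound does not depend on the convention for 0 `^ 0,
   unlike the existence of a minimiser. *)
Definition best_rate : R := inf [set rate q | q in [set q | 0 <= q <= 1]].

End Bound.

(* Main.v *)
(* Every policy earns at most the sum over t of max_i mu_i(t), so it suffices to
   compare each round with max_i mu_i(t).

   For a given arm and number of pulls, the error of the estimator is a weighted
   sum of the noises of the pulls; an exponential supermartingale and Chernoff's
   bound show that, up to probability O(1/t), all estimators are within beta of
   their noiseless versions at round t. On that event concavity makes every index
   at least mu_i(t), hence the round costs at most the bias of the arm played plus
   2 beta.

   Let this arm have N pulls and window h, and let n_l be its number of triggers
   at its l-th pull. The bias is at most t (n_N - n_M) gamma(M) / h, where
   M = N - 2h + 1, hence at most 2 t^2 gamma(M) / (eps N) because n_N <= t. As
   gamma^q is decreasing, gamma(M)^q is at most 1/M times its sum up to T, so that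
   min(1, x) <= x^(q/(1+q)) yields a cost O(T^(2q/(1+q)) Upsilon^(1/(1+q)) / N);
   similarly min(1, 2 beta) = O((sigma T)^(2/3) log T / N). Summing 1/N over the
   pulls only costs a logarithm. Finally Upsilon up to T is at most 2 |B| times
   Upsilon up to T / |B| for any clique B, so that the term of a single clique
   already dominates the bias. *)

Require Import Defs.
From HB Require Import structures.
From mathcomp Require Import all_boot all_order all_algebra.
From mathcomp Require Import all_classical all_reals all_analysis.
From mathcomp Require Import measurable_realfun ring lra zify.

Set Implicit Arguments.
Unset Strict Implicit.
Unset Printing Implicit Defensive.

Import Order.TTheory GRing.Theory Num.Theory.
Import numFieldNormedType.Exports.

Local Open Scope classical_set_scope.
Local Open Scope ring_scope.

(** * Integrating one more round *)

Lemma integral_round_kernel {R : realType} {k : nat} (nu : environment R k)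
    (G : 'M[bool]_k.+1) (pol : policy R k) t (h : t.-tuple (obs R k))
    (f : t.+1.-tuple (obs R k) -> \bar R) :
  (forall z, 0 <= f z)%E -> measurable_fun [set: _] f ->
  (\int[round_kernel nu G pol h]_z f z =
   \int[pol t h]_i \int[nu i (triggers G i (rcons (arms h) i))]_x
     f [tuple of rcons h (i, x)])%E.
Proof.
move=> f0 mf; rewrite [LHS]integral_kcomp//; apply: eq_integral => i _.
rewrite [LHS]integral_kcomp//; apply: eq_integral => x _.
by rewrite integral_dirac// diracT mul1e.
Qed.

Section LiftedRound.
Context {R : realType} {k : nat} (nu : environment R k) (G : 'M[bool]_k.+1).
Context (pol : policy R k) (t : nat).

(* [integral_kcomp] is about compositions of kernels: the law of the first
   rounds is seen as a kernel from [unit]. *)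
Definition lifted_round (z : unit * t.-tuple (obs R k))
    : {measure set (t.+1.-tuple (obs R k)) -> \bar R} :=
  round_kernel nu G pol z.2.

Let measurable_lifted_round U : measurable U ->
  measurable_fun [set: _] (lifted_round ^~ U).
Proof.
move=> mU; apply: (measurableT_comp (measurable_kernel (round_kernel nu G pol (t:=t)) U mU)).
exact: measurable_snd.
Qed.

HB.instance Definition _ := isKernel.Build _ _ _ _ R
  lifted_round measurable_lifted_round.

Let lifted_roundT z : lifted_round z [set: _] = 1%E.
Proof. exact: round_kernelT. Qed.

HB.instance Definition _ := Kernel_isProbability.Build _ _ _ _ R
  lifted_round lifted_roundT.

Lemma integral_extend (P : probability (t.-tuple (obs R k)) R)
    (f : t.+1.-tuple (obs R k) -> \bar R) :
  (forall z, 0 <= f z)%E -> measurable_fun [set: _] f ->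
  (\int[extend_prob nu G pol P]_z f z =
   \int[P]_h \int[pol t h]_i \int[nu i (triggers G i (rcons (arms h) i))]_x
     f [tuple of rcons h (i, x)])%E.
Proof.
move=> f0 mf.
have mP : measurable_fun [set: unit] (fun=> P : pprobability _ _).
  exact: measurable_cst.
have -> : (\int[extend_prob nu G pol P]_z f z =
    \int[(kprobability mP \; lifted_round)%E tt]_z f z)%E.
  exact: eq_measure_integral.
rewrite integral_kcomp//; apply: eq_integral => h _.
exact: integral_round_kernel.
Qed.

End LiftedRound.

(** * Pulls and triggers along a history *)

Section PullTimes.
Context {k : nat}.
Implicit Types (s : seq 'I_k.+1) (i j : 'I_k.+1) (G : 'M[bool]_k.+1).

Definition pull_times i s : seq nat :=
  [seq tau <- iota 0 (size s) | nth ord0 s tau == i].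

(* Rounds are counted from 0, pulls from 1. *)
Definition pull_time i s (l : nat) : nat := nth 0%N (pull_times i s) l.-1.

(* The paper's [n] at the [l]-th pull of [i], [l >= 1]. *)
Definition trigger_at G i s (l : nat) : nat :=
  triggers G i (take (pull_time i s l).+1 s).

Lemma pull_times_rcons i s j : pull_times i (rcons s j) =
  if j == i then rcons (pull_times i s) (size s) else pull_times i s.
Proof.
rewrite /pull_times size_rcons -[X in iota 0 X]addn1 iotaD cats1 filter_rcons.
rewrite add0n nth_rcons ltnn eqxx.
have -> : [seq tau <- iota 0 (size s) | nth ord0 (rcons s j) tau == i] =
          [seq tau <- iota 0 (size s) | nth ord0 s tau == i].
  by apply: eq_in_filter => tau; rewrite mem_iota /= nth_rcons => ->.
by [].
Qed.

Lemma pulls_rcons i s j : pulls i (rcons s j) = (pulls i s + (j == i))%N.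
Proof. by rewrite /pulls -cats1 count_cat /= addn0. Qed.

Lemma triggers_rcons G i s j : triggers G i (rcons s j) = (triggers G i s + G j i)%N.
Proof. by rewrite /triggers -cats1 count_cat /= addn0. Qed.

Lemma size_pull_times i s : size (pull_times i s) = pulls i s.
Proof.
elim/last_ind: s => //= s j IH; rewrite pull_times_rcons pulls_rcons -IH.
by case: eqVneq => _; rewrite ?size_rcons ?addn1 ?addn0.
Qed.

Lemma pulls_take_le i s t : (pulls i (take t s) <= pulls i s)%N.
Proof. by rewrite -{2}(cat_take_drop t s) /pulls count_cat leq_addr. Qed.

Lemma triggers_take_le G i s t : (triggers G i (take t s) <= triggers G i s)%N.
Proof. by rewrite -{2}(cat_take_drop t s) /triggers count_cat leq_addr. Qed.

Lemma pull_times_take i s t :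
  pull_times i (take t s) = take (pulls i (take t s)) (pull_times i s).
Proof.
elim/last_ind: s => //= s j IH; rewrite -cats1 take_cat.
case: ltnP => ts.
  rewrite cats1 pull_times_rcons IH.
  case: ifP => // _; rewrite -cats1 takel_cat // size_pull_times.
  exact: pulls_take_le.
case: (t - size s)%N => [|d] /=; last by rewrite cats1 -size_pull_times take_size.
rewrite cats0 cats1 pull_times_rcons -size_pull_times.
case: ifP => _; last by rewrite take_size.
by rewrite -cats1 take_size_cat.
Qed.

Lemma pull_time_take i s t l : (0 < l <= pulls i (take t s))%N ->
  pull_time i (take t s) l = pull_time i s l.
Proof.
case: l => // l /andP[_ lp].
by rewrite /pull_time pull_times_take nth_take.
Qed.

Lemma pull_timeP i s l : (0 < l <= pulls i s)%N ->
  (pull_time i s l < size s)%N /\ nth ord0 s (pull_time i s l) = i.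
Proof.
case: l => // l /andP[_ lp].
have : pull_time i s l.+1 \in pull_times i s by rewrite mem_nth// size_pull_times.
by rewrite mem_filter mem_iota add0n /= => /andP[/eqP].
Qed.

Lemma trigger_at_take G i s t l : (0 < l <= pulls i (take t s))%N ->
  trigger_at G i (take t s) l = trigger_at G i s l.
Proof.
move=> lp; have [] := pull_timeP lp; rewrite pull_time_take// => lt _.
rewrite /trigger_at pull_time_take// take_takel//.
by apply: leq_trans lt _; rewrite size_take; case: ltnP.
Qed.

Lemma trigger_at_rcons G i s j l : (0 < l <= pulls i s)%N ->
  trigger_at G i (rcons s j) l = trigger_at G i s l.
Proof.
move=> lp; have e : take (size s) (rcons s j) = s by rewrite -cats1 take_size_cat.
by rewrite -[in RHS]e trigger_at_take// e.
Qed.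

Lemma trigger_at_last G i s : 
  trigger_at G i (rcons s i) (pulls i s).+1 = triggers G i (rcons s i).
Proof.
rewrite /trigger_at /pull_time pull_times_rcons eqxx /= nth_rcons.
by rewrite size_pull_times ltnn eqxx -(size_rcons s i) take_size.
Qed.

Lemma trigger_at_le G i s l : (trigger_at G i s l <= triggers G i s)%N.
Proof. exact: triggers_take_le. Qed.

Lemma triggers_le_size G i s : (triggers G i s <= size s)%N.
Proof. exact: count_size. Qed.

(** The self-loop [G i i] makes every pull of [i] one of its triggers. Means are thus sampled at
    trigger counts at least as spread out as the pulls, which makes concavity usable without knowing
    [G]. *)
Lemma trigger_at_ltS G i s l : G i i -> (0 < l < pulls i s)%N ->
  (trigger_at G i s l < trigger_at G i s l.+1)%N.
Proof.
move=> Gii; elim/last_ind: s => [|s j IH]; first by case: l.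
rewrite pulls_rcons => /andP[l0 lp].
case: (ltnP l (pulls i s)) => ls.
  by rewrite !trigger_at_rcons ?IH ?l0// ltnW.
have ji : j = i by apply/eqP; move: lp; case: (j == i); rewrite // addn0; lia.
rewrite {j}ji eqxx addn1 in lp *; have -> : l = pulls i s by lia.
rewrite trigger_at_last trigger_at_rcons; last by lia.
by rewrite triggers_rcons Gii addn1 ltnS trigger_at_le.
Qed.

Lemma trigger_at_dist G i s l d : G i i -> (0 < l)%N -> (l + d <= pulls i s)%N ->
  (trigger_at G i s l + d <= trigger_at G i s (l + d))%N.
Proof.
move=> Gii l0; elim: d => [|d IH] ld; first by rewrite !addn0.
rewrite !addnS; apply: leq_ltn_trans (IH _) (trigger_at_ltS Gii _); lia.
Qed.

Lemma trigger_at_ge G i s l : G i i -> (0 < l <= pulls i s)%N ->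
  (l <= trigger_at G i s l)%N.
Proof.
move=> Gii /andP[l0 lp].
have [lt e] := @pull_timeP i s 1 (leq_trans l0 lp).
have g0 : (0 < trigger_at G i s 1)%N.
  by rewrite /trigger_at (take_nth ord0 lt) triggers_rcons e Gii addn1.
have := @trigger_at_dist G i s 1 l.-1 Gii isT.
by rewrite add1n prednK// => /(_ lp); lia.
Qed.

(** Each value [N] below the final number of pulls of [i] is the count before exactly one pull of
    [i]. Costs of the form [K / N] thus become one harmonic sum per arm. *)
Lemma sum_pulls (V : nmodType) (f : 'I_k.+1 -> nat -> V) s :
  \sum_(t < size s) f (nth ord0 s t) (pulls (nth ord0 s t) (take t s)) =
  \sum_i \sum_(N < pulls i s) f i N.
Proof.
elim/last_ind: s => [|s j IH].
  by rewrite big_ord0 big1// => i _; rewrite big_ord0.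
rewrite size_rcons big_ord_recr /= nth_rcons ltnn eqxx.
rewrite (_ : take (size s) (rcons s j) = s); last by rewrite -cats1 take_size_cat.
rewrite (eq_bigr (fun t : 'I_(size s) =>
    f (nth ord0 s t) (pulls (nth ord0 s t) (take t s)))); last first.
  move=> t _; rewrite nth_rcons ltn_ord -cats1 takel_cat//.
  exact/ltnW/ltn_ord.
rewrite IH (bigD1 j)//= [RHS](bigD1 j)//= pulls_rcons eqxx addn1 big_ord_recr/=.
rewrite -!addrA; congr (_ + _); rewrite addrC; congr (_ + _).
by apply: eq_bigr => i ij; rewrite pulls_rcons eq_sym (negbTE ij) addn0.
Qed.

End PullTimes.

Section PullReward.
Context {R : realType} {k : nat}.
Implicit Types (h : seq (obs R k)) (i : 'I_k.+1).

Lemma arms_rcons h z : arms (rcons h z) = rcons (arms h) z.1.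
Proof. exact: map_rcons. Qed.

Lemma size_arms h : size (arms h) = size h.
Proof. exact: size_map. Qed.

Lemma size_pull_rewards h i :
  size [seq (z.2 : R) | z <- h & z.1 == i] = pulls i (arms h).
Proof. by rewrite size_map size_filter /pulls /arms count_map. Qed.

Lemma pull_reward_rcons h z i l : (0 < l <= pulls i (arms h))%N ->
  pull_reward (rcons h z) i l = pull_reward h i l.
Proof.
case: l => // l /andP[_ lp]; rewrite /pull_reward filter_rcons.
case: ifP => // _; rewrite map_rcons nth_rcons.
by rewrite size_pull_rewards lp.
Qed.

Lemma pull_reward_last h x i :
  pull_reward (rcons h (i, x)) i (pulls i (arms h)).+1 = x.
Proof.
rewrite /pull_reward filter_rcons eqxx map_rcons nth_rcons.
by rewrite size_pull_rewards ltnn eqxx.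
Qed.

(** The position of the reward depends on the arms alone, so that for a fixed sequence of arms it is
    a mere coordinate of the history. *)
Lemma pull_rewardE h i l : (0 < l <= pulls i (arms h))%N ->
  pull_reward h i l = (nth (ord0, 0) h (pull_time i (arms h) l)).2.
Proof.
elim/last_ind: h => [|h [j x] IH]; first by case: l.
rewrite arms_rcons pulls_rcons /= => /andP[l0 lp].
case: (leqP l (pulls i (arms h))) => ls.
  have [] := @pull_timeP _ i (arms h) l; first by rewrite l0.
  rewrite size_arms => lt _.
  rewrite pull_reward_rcons ?IH ?l0//.
  have e : take (size h) (rcons (arms h) j) = arms h.
    by rewrite -cats1 take_size_cat// size_arms.
  have := @pull_time_take _ i (rcons (arms h) j) (size h) l.
  rewrite e l0 ls => /(_ isT) et; rewrite et in lt *.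
  by rewrite nth_rcons lt.
have ji : j = i by apply/eqP; move: lp; case: (j == i); rewrite // addn0; lia.
rewrite {j}ji eqxx addn1 in lp *; have -> : l = (pulls i (arms h)).+1 by lia.
rewrite pull_reward_last /pull_time pull_times_rcons eqxx /= nth_rcons.
by rewrite size_pull_times ltnn eqxx size_arms nth_rcons ltnn eqxx.
Qed.

End PullReward.

(** * Concentration of the estimators *)

Section MeasurableHistories.
Context {R : realType} {k : nat} (t : nat).
Implicit Types (i : 'I_k.+1) (h : t.-tuple (obs R k)).

(** Sequences of [t] arms are finite in number and each determines a measurable set of histories; on
    such a set counts, pull times and windows are constant. *)
Lemma measurable_arms_piecewise d (T' : measurableType d)
    (f : t.-tuple (obs R k) -> T')
    (g : t.-tuple 'I_k.+1 -> t.-tuple (obs R k) -> T') :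
  (forall s, measurable_fun [set: _] (g s)) ->
  (forall h, f h = g (arms_tuple h) h) ->
  measurable_fun [set: _] f.
Proof.
move=> mg fg _ B mB; rewrite setTI.
have -> : f @^-1` B = \bigcup_(s in [set: t.-tuple 'I_k.+1])
    (@arms_tuple R k t @^-1` [set s] `&` g s @^-1` B).
  apply/seteqP; split=> [h /= Bh|h [s _ [/= <-]]]; last by rewrite -fg.
  by exists (arms_tuple h) => //; rewrite /preimage/= -fg.
apply: fin_bigcup_measurable => [|s _]; first exact: finite_finset.
apply: measurableI; first exact: measurable_arms.
by rewrite -[X in measurable X]setTI; exact: mg.
Qed.

Lemma measurable_of_arms d (T' : measurableType d) (g : seq 'I_k.+1 -> T') :
  measurable_fun [set: _] (fun h => g (arms h)).
Proof.
apply: (@measurable_arms_piecewise _ _ _ (fun s _ => g s)) => // s.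
Qed.

Lemma measurable_pull_reward i l :
  measurable_fun [set: _] (fun h => pull_reward h i l : R).
Proof.
(* Through [l.-1], the index 0 reads the same reward as the index 1. *)
suff H l' : measurable_fun [set: _] (fun h => pull_reward h i l'.+1 : R).
  by case: l => [|l]; exact: H.
apply: (@measurable_arms_piecewise _ _ _ (fun s h =>
  if (l' < pulls i s)%N then (nth (ord0, 0) h (pull_time i s l'.+1)).2 else 0)).
  move=> s /=; case: (ltnP l' (pulls i s)) => lp; last exact: measurable_cst.
  have [lt _] := @pull_timeP _ i s l'.+1 lp; rewrite size_tuple in lt.
  rewrite (_ : (fun _ => _) = snd \o (fun h => tnth h (Ordinal lt))).
    by apply: measurableT_comp; [exact: measurable_snd|exact: measurable_tnth].
  by apply/funext => h /=; rewrite (tnth_nth (ord0, 0)).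
move=> h /=; case: ltnP => lp; first by rewrite pull_rewardE.
by rewrite /pull_reward nth_default// size_pull_rewards.
Qed.

End MeasurableHistories.

(** * The exponential supermartingale of the noise *)

Section Noise.
Context {R : realType} {k : nat}.
Variables (nu : environment R k) (G : 'M[bool]_k.+1) (i : 'I_k.+1) (W : nat -> R).
Implicit Types (h : seq (obs R k)).

Definition noise h l : R :=
  pull_reward h i l - mean nu i (trigger_at G i (arms h) l).

Definition weighted_noise h : R :=
  \sum_(1 <= l < (pulls i (arms h)).+1) W l * noise h l.

(** Times [sigma ^+ 2], this is the variance proxy of the weighted noise after [N] pulls. *)
Definition weight_energy (N : nat) : R := \sum_(1 <= l < N.+1) W l ^+ 2.

Lemma weighted_noise_rcons h j x : weighted_noise (rcons h (j, x)) =
  weighted_noise h +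
  (if j == i then W (pulls i (arms h)).+1
     * (x - mean nu i (triggers G i (rcons (arms h) i))) else 0).
Proof.
rewrite /weighted_noise arms_rcons pulls_rcons /=.
have H : \sum_(1 <= l < (pulls i (arms h)).+1) W l * noise (rcons h (j, x)) l =
         \sum_(1 <= l < (pulls i (arms h)).+1) W l * noise h l.
  apply: eq_big_nat => l; rewrite ltnS => lp.
  by rewrite /noise pull_reward_rcons// arms_rcons trigger_at_rcons.
case: eqVneq H => [->|ji] H; last by rewrite addn0 H addr0.
rewrite addn1 big_nat_recr//= H; congr (_ + _).
by rewrite /noise pull_reward_last arms_rcons trigger_at_last.
Qed.

Lemma measurable_weighted_noise t :
  measurable_fun [set: t.-tuple (obs R k)] (fun h : t.-tuple (obs R k) => weighted_noise h).
Proof.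
pose g (s : t.-tuple 'I_k.+1) (h : t.-tuple (obs R k)) : R :=
  \sum_(1 <= l < (pulls i s).+1)
     W l * (pull_reward h i l - mean nu i (trigger_at G i s l)).
apply: (@measurable_arms_piecewise R k t _ _ _ g) => // s.
apply: measurable_sum => l; apply: measurable_funM; first exact: measurable_cst.
by apply: measurable_funB; [exact: measurable_pull_reward|exact: measurable_cst].
Qed.

Variables (sigma : R) (pol : policy R k).
Hypotheses (subg : subgaussian sigma nu) (Gii : G i i).

(* A supermartingale: by subgaussianity, a new pull multiplies it by a factor of
   conditional mean at most 1. *)
Definition exp_noise h : R :=
  expR (weighted_noise h - sigma ^+ 2 / 2 * weight_energy (pulls i (arms h))).

Lemma measurable_exp_noise t :
  measurable_fun [set: t.-tuple (obs R k)] (fun h : t.-tuple (obs R k) => exp_noise h).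
Proof.
apply: measurableT_comp; first exact: measurable_expR.
apply: measurable_funB; first exact: measurable_weighted_noise.
exact: (@measurable_of_arms R k t _ _ (fun s => sigma ^+ 2 / 2 * weight_energy (pulls i s))).
Qed.

Lemma exp_noise_step t (h : t.-tuple (obs R k)) j :
  (\int[nu j (triggers G j (rcons (arms h) j))]_x (exp_noise (rcons h (j, x)))%:E
   <= (exp_noise h)%:E)%E.
Proof.
have [->|ji] := eqVneq j i; last first.
  rewrite (eq_integral (cst (exp_noise h)%:E)) => [|x _].
    rewrite integral_cst// [X in (_ * X)%E](_ : _ = 1%E) ?mule1//.
    exact: probability_setT.
  rewrite /exp_noise weighted_noise_rcons arms_rcons pulls_rcons /=.
  by rewrite (negbTE ji) addr0 addn0.
set n := triggers _ _ _; pose w := W (pulls i (arms h)).+1.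
(* Subgaussianity is assumed from the first trigger on; the round being played triggers [i] through
   its self-loop. *)
have n0 : (0 < n)%N by rewrite /n triggers_rcons Gii addn1.
rewrite (eq_integral (fun x : measurableTypeR R => (exp_noise h * expR (- (w ^+ 2 * sigma ^+ 2 / 2)))%:E
    * (expR (w * ((x : R) - mean nu i n)))%:E)%E) => [|x _]; last first.
  rewrite -EFinM -!expRD; congr (expR _)%:E.
  rewrite weighted_noise_rcons arms_rcons pulls_rcons /= eqxx addn1.
  by rewrite /weight_energy big_nat_recr//= -/n -/w; ring.
rewrite ge0_integralZl_EFin//; last 2 first.
- apply/measurable_EFinP; apply: measurableT_comp; first exact: measurable_expR.
  apply: measurable_funM; first exact: measurable_cst.
  by apply: measurable_funB; [exact: measurable_id|exact: measurable_cst].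
- by rewrite mulr_ge0// expR_ge0.
have := subg i n0 w; rewrite /mmt_gen_fun expectation.unlock => le.
apply: (@le_trans _ _ ((exp_noise h * expR (- (w ^+ 2 * sigma ^+ 2 / 2)))%:E *
   (expR (w ^+ 2 * sigma ^+ 2 / 2))%:E)%E).
  rewrite lee_pmul2l ?lte_fin ?mulr_gt0 ?expR_gt0//.
  apply: le_trans le; rewrite le_eqVlt; apply/orP; left; apply/eqP.
  by apply: eq_integral => x _ /=; rewrite mulrC.
by rewrite -EFinM expRN divfK ?gt_eqF ?expR_gt0.
Qed.

Lemma integral_exp_noise t :
  (\int[trajectory_law nu G pol t]_h (exp_noise h)%:E <= 1)%E.
Proof.
have ge0 t' (h : t'.-tuple (obs R k)) : (0 <= (exp_noise h)%:E)%E.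
  by rewrite lee_fin expR_ge0.
have mE t' : measurable_fun [set: t'.-tuple (obs R k)]
      (fun h : t'.-tuple (obs R k) => (exp_noise h)%:E).
  by apply/measurable_EFinP; exact: measurable_exp_noise.
elim: t => [|t IH] /=.
  have e0 : exp_noise ([tuple] : 0.-tuple (obs R k)) = 1.
    rewrite /exp_noise /weighted_noise /weight_energy /=.
    by rewrite !big_geq// mulr0 subr0 expR0.
  rewrite integral_dirac; [|exact: measurableT|exact: mE].
  by rewrite e0 mule1 probability_le1.
rewrite integral_extend//; apply: le_trans IH.
have mI : measurable_fun [set: t.-tuple (obs R k)] (fun h : t.-tuple (obs R k) =>
    \int[pol t h]_j \int[nu j (triggers G j (rcons (arms h) j))]_x
      (exp_noise [tuple of rcons h (j, x)])%:E)%E.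
  (* The iterated integral is an integral against [round_kernel], hence measurable in the starting
     history. *)
  have := measurable_fun_integral_kernel
    (measurable_kernel (round_kernel nu G pol (t:=t))) (ge0 _) (mE _).
  apply: eq_measurable_fun => h _.
  exact: (integral_round_kernel _ _ _ _ (ge0 _) (mE _)).
apply: ge0_le_integral => // [h _||h _]; [|exact: mE|].
  by apply: integral_ge0 => j _; apply: integral_ge0.
(* As [pol t h] has mass 1, the constant becomes an integral that can be compared arm by arm. *)
have -> : ((exp_noise h)%:E = \int[pol t h]_j (cst (exp_noise h)%:E) j)%E.
  by rewrite integral_cst// prob_kernel mule1.
apply: ge0_le_integral => // [j _|j _]; first exact: integral_ge0.
exact: exp_noise_step.
Qed.

End Noise.

Lemma measurable_bool_set d (T : measurableType d) (b : T -> bool) :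
  measurable_fun [set: T] b -> measurable [set x | b x].
Proof. by move=> mb; have := mb measurableT [set true] I; rewrite setTI. Qed.

Lemma measurable_exists d (T : measurableType d) (I : finType) (b : I -> T -> bool) :
  (forall x, measurable_fun [set: T] (b x)) ->
  measurable_fun [set: T] (fun h => [exists x, b x h]).
Proof.
move=> mb; rewrite (_ : (fun _ => _) = (fun h => has (b^~ h) (index_enum I))).
  elim: (index_enum I) => [|x s IH] /=; first exact: measurable_cst.
  exact: measurable_or.
by apply/funext => h; apply/existsP/hasP => [[x bx]|[x _ bx]]; exists x.
Qed.

Lemma union_bound d (T : measurableType d) {R : realType} (P : {measure set T -> \bar R})
    (I : finType) (b : I -> T -> bool) :
  (forall x, measurable_fun [set: T] (b x)) ->
  (P [set h | [exists x, b x h]] <= \sum_x P [set h | b x h])%E.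
Proof.
move=> mb; pose B s := [set h : T | has (b^~ h) s].
have mB s : measurable (B s).
  apply: measurable_bool_set; elim: s => [|x s IH] /=; first exact: measurable_cst.
  exact: measurable_or.
suff H (s : seq I) : (P (B s) <= \sum_(x <- s) P [set h | b x h])%E.
  apply: le_trans (H (index_enum I)); apply: le_measure; rewrite ?inE//.
    exact/measurable_bool_set/measurable_exists.
  by move=> h /= /existsP[x bx]; apply/hasP; exists x.
elim: s => [|x s IH].
  by rewrite big_nil (_ : B [::] = set0) ?measure0//; apply/seteqP; split.
rewrite big_cons; apply: le_trans (leeD2l _ IH).
rewrite (_ : B (x :: s) = [set h | b x h] `|` B s).
  by apply: measureU2 => //; exact: measurable_bool_set.
by apply/seteqP; split=> h /= /orP.
Qed.

(** * Tail of the weighted noise *)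

Section Tail.
Context {R : realType} {k : nat}.
Variables (nu : environment R k) (G : 'M[bool]_k.+1) (i : 'I_k.+1) (sigma : R).
Variable (pol : policy R k).
Hypotheses (subg : subgaussian sigma nu) (Gii : G i i).

Lemma weighted_noiseZ (W : nat -> R) a (h : seq (obs R k)) :
  weighted_noise nu G i (fun l => a * W l) h = a * weighted_noise nu G i W h.
Proof. by rewrite [RHS]mulr_sumr; apply: eq_bigr => l _; rewrite mulrA. Qed.

Lemma weight_energyZ (W : nat -> R) a N :
  weight_energy (fun l => a * W l) N = a ^+ 2 * weight_energy W N.
Proof. by rewrite [RHS]mulr_sumr; apply: eq_bigr => l _; rewrite exprMn. Qed.

Lemma measurable_pulls_eq t N :
  measurable_fun [set: t.-tuple (obs R k)]
    (fun h : t.-tuple (obs R k) => pulls i (arms h) == N).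
Proof. exact: (@measurable_of_arms R k t _ _ (fun s => pulls i s == N)). Qed.

(** Markov's inequality for the supermartingale with weights [lambda * W]: on the event, [c] times
    it is at least 1. Fixing the number of pulls to [N] makes the energy deterministic. *)
Lemma noise_chernoff (W : nat -> R) t N (V lambda b : R) : 0 <= lambda ->
  weight_energy W N <= V ->
  (trajectory_law nu G pol t [set h : t.-tuple (obs R k) | (pulls i (arms h) == N) &&
      (b <= weighted_noise nu G i W h)%R]
   <= (expR (lambda ^+ 2 * sigma ^+ 2 * V / 2 - lambda * b))%:E)%E.
Proof.
move=> l0 WV; set A := [set h | _]; set c := expR _.
pose f (h : t.-tuple (obs R k)) := exp_noise nu G i (fun l => lambda * W l) sigma h.
have mA : measurable A.
  apply/measurable_bool_set/measurable_and; first exact: measurable_pulls_eq.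
  by apply: measurable_fun_ler; [exact: measurable_cst|exact: measurable_weighted_noise].
have mf : measurable_fun [set: t.-tuple (obs R k)] (fun h => (f h)%:E).
  by apply/measurable_EFinP; exact: measurable_exp_noise.
apply: (@le_trans _ _ (c%:E * \int[trajectory_law nu G pol t]_h (f h)%:E)%E); last first.
  rewrite -[leRHS]mule1 lee_pmul2l ?lte_fin ?expR_gt0//.
  exact: integral_exp_noise.
rewrite -ge0_integralZl_EFin ?expR_ge0//; last by move=> h _; rewrite lee_fin expR_ge0.
rewrite -[A]setIT -integral_indic//.
apply: ge0_le_integral => //.
- by apply/measurable_EFinP; exact: measurable_indic.
- exact: measurable_funeM.
move=> h _; rewrite -EFinM lee_fin indicE.
have [|_] := boolP (h \in A); last by rewrite mulr_ge0 ?expR_ge0.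
rewrite inE /A /= => /andP[/eqP pN bS].
rewrite -expRD -[leLHS]expR0 ler_expR pN weighted_noiseZ weight_energyZ.
have : lambda * b <= lambda * weighted_noise nu G i W h by rewrite ler_wpM2l.
have : (lambda ^+ 2 * sigma ^+ 2) / 2 * weight_energy W N <=
    (lambda ^+ 2 * sigma ^+ 2) / 2 * V.
  by rewrite ler_wpM2l// divr_ge0// -exprMn sqr_ge0.
move: (weighted_noise _ _ _ _ _) (weight_energy _ _) => S E H1 H2.
rewrite -subr_ge0; move: H1 H2; rewrite -subr_ge0 => H1; rewrite -subr_ge0 => H2.
apply: le_trans (addr_ge0 H1 H2) _; rewrite le_eqVlt; apply/orP; left; apply/eqP; ring.
Qed.

Lemma noise_tail (W : nat -> R) t N (V L : R) : 0 <= sigma -> 0 < V -> 0 <= L ->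
  weight_energy W N <= V ->
  (trajectory_law nu G pol t [set h : t.-tuple (obs R k) | (pulls i (arms h) == N) &&
      (sigma * Num.sqrt (2 * V * L) < weighted_noise nu G i W h)%R]
   <= (expR (- L))%:E)%E.
Proof.
move=> s0 V0 L0 WV.
have mle b : measurable [set h : t.-tuple (obs R k) | (pulls i (arms h) == N) &&
      (b <= weighted_noise nu G i W h)].
  apply/measurable_bool_set/measurable_and; first exact: measurable_pulls_eq.
  by apply: measurable_fun_ler; [exact: measurable_cst|exact: measurable_weighted_noise].
have mlt b : measurable [set h : t.-tuple (obs R k) | (pulls i (arms h) == N) &&
      (b < weighted_noise nu G i W h)].
  apply/measurable_bool_set/measurable_and; first exact: measurable_pulls_eq.
  by apply: measurable_fun_ltr; [exact: measurable_cst|exact: measurable_weighted_noise].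
move: s0; rewrite le_eqVlt => /orP[/eqP s0|s0].
  (* The threshold vanishes, so the event is the increasing union of the events
     with thresholds 1 / (n + 1), and Chernoff's exponent is unbounded. *)
  rewrite -s0 mul0r.
  pose F n := [set h : t.-tuple (obs R k) | (pulls i (arms h) == N) &&
      (n.+1%:R^-1 <= weighted_noise nu G i W h)].
  have FU : [set h : t.-tuple (obs R k) | (pulls i (arms h) == N) &&
      (0 < weighted_noise nu G i W h)] = \bigcup_n F n.
    apply/seteqP; split=> [h /= /andP[pN S0]|h [n _ /= /andP[-> le]]].
      exists (Num.truncn (weighted_noise nu G i W h)^-1) => //=.
      rewrite /F /= pN /= invf_ple ?posrE ?ltr0Sn// ltW//.
      by rewrite truncnS_gt// ?invr_ge0 ?ltW.
    by apply: lt_le_trans le; rewrite invr_gt0.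
  rewrite FU; have mF n : measurable (F n) by exact: mle.
  apply: (cvge_le _ (nondecreasing_cvg_mu mF _ _)); last 2 first.
  - exact: bigcup_measurable.
  - move=> m n mn; apply/subsetPset => h; rewrite /F /= => /andP[-> le]; apply: le_trans le.
    by rewrite lef_pV2 ?posrE// ler_nat.
  near=> n; apply: le_trans (noise_chernoff t n.+1%:R^-1 (lambda := n.+1%:R * L) _ WV) _.
    by rewrite mulr_ge0.
  rewrite -s0 lee_fin ler_expR expr0n/= mulr0 !mul0r sub0r lerN2.
  by rewrite mulrAC divff// mul1r.
set b := sigma * _.
apply: (@le_trans _ _ (trajectory_law nu G pol t [set h : t.-tuple (obs R k) |
    (pulls i (arms h) == N) && (b <= weighted_noise nu G i W h)%R])).
  by apply: le_measure; rewrite ?inE// => h /= /andP[-> /ltW].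
have sV0 : 0 < sigma ^+ 2 * V by rewrite mulr_gt0// exprn_gt0.
(* This [lambda] minimises the exponent, whose value [- b ^+ 2 / (2 * sigma ^+ 2 * V)] is [- L] by
   the choice of [b]. *)
apply: le_trans (noise_chernoff t b (lambda := b / (sigma ^+ 2 * V)) _ WV) _.
  by rewrite divr_ge0 ?(ltW sV0)// mulr_ge0 ?sqrtr_ge0 ?ltW.
have b2 : b ^+ 2 = sigma ^+ 2 * (2 * V * L).
  by rewrite exprMn sqr_sqrtr// !mulr_ge0// ltW.
rewrite lee_fin ler_expR le_eqVlt; apply/orP; left; apply/eqP.
have -> : (b / (sigma ^+ 2 * V)) ^+ 2 * sigma ^+ 2 * V / 2 - b / (sigma ^+ 2 * V) * b
    = - (b ^+ 2 / (2 * sigma ^+ 2 * V)).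
  by field; rewrite !gt_eqF.
by rewrite b2; field; rewrite !gt_eqF.
Unshelve. all: by end_near. Qed.

End Tail.

(** * The estimator as a weighted sum *)

Section IndexWeights.
Context {R : realType}.
Variables (rd M w : nat).

(* Coefficients of the pulls in the centered estimator of an arm pulled
   [M + w + w] times: each pull of the last window also enters, through the
   slope, the coefficient of the pull [w] steps before. *)
Definition index_weight (l : nat) : R :=
  if (M + w < l)%N then w%:R^-1 * (1 + (rd%:R - l%:R) / w%:R)
  else if (M < l)%N then - (w%:R^-1 * ((rd%:R - (l + w)%:R) / w%:R)) else 0.

Lemma index_weight0 l : (l < M.+1)%N -> index_weight l = 0.
Proof.
by rewrite ltnS /index_weight => lM; rewrite !ltnNge lM (leq_trans lM (leq_addr _ _)).
Qed.

Lemma index_weightE (e : nat -> R) :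
  w%:R^-1 * \sum_((M + w).+1 <= l < (M + w + w).+1)
    (e l + (rd%:R - l%:R) * ((e l - e (l - w)%N) / w%:R)) =
  \sum_(1 <= l < (M + w + w).+1) index_weight l * e l.
Proof.
rewrite (@big_cat_nat _ _ _ M.+1 1)/= ?ltnS//; last by lia.
rewrite (@big_cat_nat _ _ _ (M + w).+1 M.+1)/= ?ltnS//; try lia.
rewrite [X in _ = X + _]big_nat_cond [X in _ = X + _]big1 ?add0r => [|l]; last first.
  by rewrite andbT => /andP[_ lM]; rewrite index_weight0 ?mul0r.
rewrite mulr_sumr.
have -> : \sum_(M.+1 <= l < (M + w).+1) index_weight l * e l =
  \sum_((M + w).+1 <= l < (M + w + w).+1)
     - (w%:R^-1 * ((rd%:R - l%:R) / w%:R)) * e (l - w)%N.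
  rewrite -[X in _ = \sum_(X <= _ < _) _]/(M.+1 + w)%N big_addn.
  rewrite (_ : ((M + w + w).+1 - w)%N = (M + w).+1); last by lia.
  apply: eq_big_nat => l /andP[Ml lM]; rewrite addnK /index_weight.
  by rewrite ltnNge -ltnS lM /= Ml.
rewrite -big_split/=; apply: eq_big_nat => l /andP[Ml lM].
by rewrite /index_weight Ml; ring.
Qed.

(** The [w] weights of the earlier window are at most [D / w ^+ 2] in absolute value, and those of
    the last window at most [2 * D / w ^+ 2] because [w <= D]. This gives
    [w * (1 + 4) * D ^+ 2 / w ^+ 4]; the 10 in [beta] is twice the resulting 5. *)
Lemma index_weight_energy : (0 < w)%N -> (M + w + w < rd)%N ->
  weight_energy index_weight (M + w + w) <=
  5 * (rd%:R - (M + w + w)%:R + w%:R - 1) ^+ 2 / w%:R ^+ 3.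
Proof.
move=> w0 Nrd; set D := _ - 1.
have w0' : 0 < w%:R :> R by rewrite ltr0n.
have wD : w%:R <= D.
  have : (M + w + w)%:R + 1 <= rd%:R :> R by rewrite natr1 ler_nat.
  by rewrite /D; lra.
have D0 : 0 <= D by apply: le_trans wD.
rewrite /weight_energy (@big_cat_nat _ _ _ M.+1 1)/= ?ltnS//; last by lia.
rewrite (@big_cat_nat _ _ _ (M + w).+1 M.+1)/= ?ltnS//; try lia.
rewrite [X in X + _ <= _]big_nat_cond [X in X + _ <= _]big1 ?add0r => [|l]; last first.
  by rewrite andbT => /andP[_ lM]; rewrite index_weight0 ?expr0n.
have H1 : \sum_(M.+1 <= l < (M + w).+1) index_weight l ^+ 2 <= w%:R * (D ^+ 2 / w%:R ^+ 4).
  apply: (@le_trans _ _ (\sum_(M.+1 <= l < (M + w).+1) (D ^+ 2 / w%:R ^+ 4))).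
    apply: ler_sum_nat => l /andP[Ml lM].
    rewrite /index_weight ltnNge -ltnS lM /= Ml sqrrN.
    have -> : (w%:R^-1 * ((rd%:R - (l + w)%:R) / w%:R)) ^+ 2 =
       (rd%:R - (l + w)%:R) ^+ 2 / w%:R ^+ 4 :> R by field; rewrite gt_eqF.
    rewrite ler_pM2r ?invr_gt0 ?exprn_gt0// lerXn2r ?nnegrE//.
      by rewrite subr_ge0 ler_nat; lia.
    rewrite /D; have : (M.+1)%:R <= l%:R :> R by rewrite ler_nat.
    by rewrite -addn1 !natrD; lra.
  by rewrite sumr_const_nat (_ : (_ - _)%N = w) -?[leLHS]mulr_natl//; lia.
have H2 : \sum_((M + w).+1 <= l < (M + w + w).+1) index_weight l ^+ 2
    <= w%:R * (4 * D ^+ 2 / w%:R ^+ 4).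
  apply: (@le_trans _ _ (\sum_((M + w).+1 <= l < (M + w + w).+1) (4 * D ^+ 2 / w%:R ^+ 4))).
    apply: ler_sum_nat => l /andP[Ml lM]; rewrite /index_weight Ml.
    have -> : (w%:R^-1 * (1 + (rd%:R - l%:R) / w%:R)) ^+ 2 =
       (w%:R + (rd%:R - l%:R)) ^+ 2 / w%:R ^+ 4 :> R by field; rewrite gt_eqF.
    rewrite ler_pM2r ?invr_gt0 ?exprn_gt0//.
    rewrite (_ : 4 * D ^+ 2 = (D + D) ^+ 2); last by ring.
    have dl : l%:R <= rd%:R :> R by rewrite ler_nat; lia.
    apply: lerXn2r; rewrite ?nnegrE; [lra|lra|].
    apply: lerD => //; rewrite /D; have : (M + w).+1%:R <= l%:R :> R by rewrite ler_nat.
    by rewrite -addn1 !natrD; lra.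
  by rewrite sumr_const_nat (_ : (_ - _)%N = w) -?[leLHS]mulr_natl//; lia.
apply: le_trans (lerD H1 H2) _; rewrite le_eqVlt; apply/orP; left; apply/eqP.
by field; rewrite gt_eqF.
Qed.

End IndexWeights.

(** * Probability of a misestimation *)

Section Misestimation.
Context {R : realType} {k : nat}.
Variables (nu : environment R k) (G : 'M[bool]_k.+1) (pol : policy R k).
Variables (sigma : R) (delta : nat -> R) (eps : R).
Implicit Types (h : seq (obs R k)) (i : 'I_k.+1).

(** The noiseless estimator: [mu_hat] with each reward replaced by its mean at the trigger count of
    the actual history. *)
Definition mu_tilde h i (w : nat) : R :=
  let N := pulls i (arms h) in
  let m l := mean nu i (trigger_at G i (arms h) l) in
  w%:R^-1 * \sum_((N - w).+1 <= l < N.+1)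
    (m l + ((round h)%:R - l%:R) * ((m l - m (l - w)%N) / w%:R)).

Definition misestimated h : bool :=
  [exists i, let w := window eps h i in
    (w != 0%N) && (beta sigma delta h i w < `|mu_hat h i w - mu_tilde h i w|)].

(** Two windows fit into the pulls, so the slopes of the estimator only compare genuine pulls and no
    subtraction is truncated. *)
Lemma window_double h i : 0 <= eps < 1 / 2 ->
  (window eps h i + window eps h i <= pulls i (arms h))%N.
Proof.
move=> /andP[e0 e1]; rewrite -(ler_nat R) natrD.
have le : (window eps h i)%:R <= eps * (pulls i (arms h))%:R.
  by rewrite /window truncn_le ?mulr_ge0.
have : eps * (pulls i (arms h))%:R <= 1 / 2 * (pulls i (arms h))%:R.
  by rewrite ler_wpM2r// ltW.
by move: le; lra.
Qed.

Lemma mu_hat_noise h i w : (w + w <= pulls i (arms h))%N ->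
  mu_hat h i w - mu_tilde h i w =
  weighted_noise nu G i (index_weight (round h) (pulls i (arms h) - w - w) w) h.
Proof.
move=> wN; rewrite /mu_hat /mu_tilde -mulrBr -sumrB /weighted_noise.
set N := pulls i (arms h) in wN *.
have {wN} [M ->] : exists M, N = (M + w + w)%N by exists (N - w - w)%N; lia.
rewrite !addnK -index_weightE.
by congr (_ * _); apply: eq_bigr => l _; rewrite /noise; ring.
Qed.

Hypotheses (subg : subgaussian sigma nu) (Gd : forall i, G i i) (s0 : 0 <= sigma).
Hypotheses (eps01 : 0 <= eps < 1 / 2).

(** A misestimation split by arm, number of pulls and sign [b] of the error. Once these are fixed
    the weights no longer depend on the history, as the tail bound requires. *)
Let event t (x : 'I_k.+1 * 'I_t.+1 * bool) (h : t.-tuple (obs R k)) : bool :=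
  let: (i, N, b) := x in
  let w := Num.truncn (eps * N%:R) in
  let D : R := t.+1%:R - N%:R + w%:R - 1 in
  let L := ln (1 / delta t.+1) in
  (w != 0%N) && ((pulls i (arms h) == N) &&
    (sigma * Num.sqrt (2 * (5 * D ^+ 2 / w%:R ^+ 3) * L) <
     weighted_noise nu G i (fun l => (-1) ^+ b *
        index_weight t.+1 (N - w - w) w l) h)).

Let misestimatedE t (h : t.-tuple (obs R k)) :
  misestimated h = [exists x, event x h].
Proof.
have pt i : (pulls i (arms h) < t.+1)%N.
  by rewrite ltnS -[X in (_ <= X)%N](size_tuple h) -(size_arms h) count_size.
have thr i : let w := window eps h i in (w != 0)%N ->
  let D : R := t.+1%:R - (pulls i (arms h))%:R + w%:R - 1 in
  sigma * Num.sqrt (2 * (5 * D ^+ 2 / w%:R ^+ 3) * ln (1 / delta t.+1)) =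
    beta sigma delta h i w.
  move=> w w0 D; rewrite /beta /round size_tuple -/D.
  have D0 : 0 <= D.
    have : (pulls i (arms h))%:R <= t%:R :> R by rewrite ler_nat -ltnS.
    have : 1 <= w%:R :> R by rewrite ler1n lt0n.
    by rewrite /D -natr1; lra.
  rewrite -[RHS]mulrA; congr (_ * _).
  rewrite (_ : 2 * _ * _ = D ^+ 2 * (10 * ln (1 / delta t.+1) / w%:R ^+ 3)); last first.
    by field; rewrite pnatr_eq0.
  by rewrite sqrtrM ?sqr_ge0// sqrtr_sqr ger0_norm.
have dbl i := window_double h i eps01.
apply/existsP/existsP => [[i /= /andP[w0]]|[[[i N] b] /=]].
  rewrite mu_hat_noise// => dev.
  have : exists b : bool, beta sigma delta h i (window eps h i) <
      (-1) ^+ b * weighted_noise nu G i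
        (index_weight (round h) (pulls i (arms h) - window eps h i - window eps h i)
           (window eps h i)) h.
    case: (lerP 0 (weighted_noise nu G i
        (index_weight (round h) (pulls i (arms h) - window eps h i - window eps h i)
           (window eps h i)) h)) => S0.
      by exists false; rewrite expr0 mul1r; rewrite ger0_norm in dev.
    by exists true; rewrite expr1 mulN1r; rewrite ltr0_norm in dev.
  case=> b devb; exists (i, Ordinal (pt i), b) => /=.
  rewrite -/(window eps h i) w0 eqxx /= thr// weighted_noiseZ.
  by move: devb; rewrite /round size_tuple.
move=> /andP[w0 /andP[/eqP pN dev]]; exists i.
have ew : Num.truncn (eps * N%:R) = window eps h i by rewrite /window pN.
rewrite -pN in dev; rewrite ew in w0 dev; rewrite w0 /= mu_hat_noise//.
rewrite thr// weighted_noiseZ in dev; apply: lt_le_trans dev _.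
rewrite /round size_tuple; apply: le_trans (ler_norm _) _.
by rewrite normrM normrX normrN1 expr1n mul1r.
Qed.

Let measurable_event t x : measurable_fun [set: _] (@event t x).
Proof.
case: x => -[i N] b; apply: measurable_and; first exact: measurable_cst.
apply: measurable_and; first exact: measurable_pulls_eq.
by apply: measurable_fun_ltr; [exact: measurable_cst|exact: measurable_weighted_noise].
Qed.

Lemma measurable_misestimated t :
  measurable_fun [set: t.-tuple (obs R k)] (fun h : t.-tuple (obs R k) => misestimated h).
Proof.
rewrite (_ : (fun _ => _) = (fun h : t.-tuple (obs R k) => [exists x, event x h])); last first.
  by apply/funext => h; exact: misestimatedE.
exact: (measurable_exists (@measurable_event t)).
Qed.

(** The tail bound with [L = ln (1 / delta)] costs [delta] for each of the [2 * k.+1 * t.+1] triples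
    of an arm, a number of pulls and a sign. *)
Lemma prob_misestimated t : 0 < delta t.+1 <= 1 ->
  (trajectory_law nu G pol t [set h : t.-tuple (obs R k) | misestimated h]
   <= (2 * k.+1%:R * t.+1%:R * delta t.+1)%:E)%E.
Proof.
move=> /andP[d0 d1].
rewrite (_ : [set h : t.-tuple (obs R k) | _] =
    [set h : t.-tuple (obs R k) | [exists x, event x h]]); last first.
  by apply/seteqP; split=> h /=; rewrite misestimatedE.
apply: le_trans (union_bound _ (@measurable_event t)) _.
apply: (@le_trans _ _ (\sum_(x : 'I_k.+1 * 'I_t.+1 * bool) (delta t.+1)%:E)%E).
  apply: lee_sum => -[[i N] b] _; rewrite /event.
  set w := Num.truncn _; set D := _ - 1 : R.
  case: (eqVneq w 0%N) => w0 /=.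
    by rewrite (_ : [set _ | _] = set0) ?measure0 ?lee_fin ?ltW//; apply/seteqP; split.
  have wN : (w + w <= N)%N.
    rewrite -(ler_nat R) natrD; have [e0 e1] := andP eps01.
    have le : w%:R <= eps * N%:R by rewrite /w truncn_le ?mulr_ge0.
    have : eps * N%:R <= 1 / 2 * N%:R :> R by rewrite ler_wpM2r// ltW.
    by move: le; lra.
  rewrite [leRHS](_ : _ = (expR (- ln (1 / delta t.+1)))%:E); last first.
    by congr (_%:E); rewrite div1r lnV ?posrE// opprK lnK ?posrE.
  have w1 : 1 <= w%:R :> R by rewrite ler1n lt0n.
  apply: noise_tail => //.
  - have D0 : 0 < D.
      have : N%:R <= t%:R :> R by rewrite ler_nat -ltnS.
      by rewrite /D -natr1; lra.
    by rewrite divr_gt0 ?mulr_gt0 ?exprn_gt0// (lt_le_trans ltr01).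
  - by rewrite ln_ge0// div1r invf_ge1.
  - rewrite weight_energyZ -exprM mulnC exprM sqrrN expr1n expr1n mul1r.
    have := @index_weight_energy R t.+1 (N - w - w) w.
    by rewrite (_ : (N - w - w + w + w)%N = N) ?lt0n; [apply|lia].
rewrite sumEFin lee_fin sumr_const -[leLHS]mulr_natl !card_prod !card_ord card_bool.
by rewrite !natrM le_eqVlt; apply/orP; left; apply/eqP; ring.
Qed.

End Misestimation.

(** * Regret of a single round *)

Section RisingMeans.
Context {R : realType} {k : nat} (nu : environment R k) (i : 'I_k.+1).
Hypothesis (nuR : rising nu).

Lemma gamma_ge0 n : (0 < n)%N -> 0 <= gamma nu i n.
Proof. exact: nuR.1. Qed.

Lemma gamma_le a d : (0 < a)%N -> gamma nu i (a + d) <= gamma nu i a.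
Proof.
move=> a0; elim: d => [|d IH]; first by rewrite addn0.
by rewrite addnS; apply: le_trans IH; apply: nuR.2; lia.
Qed.

Lemma mean_diff_le a d : (0 < a)%N ->
  mean nu i (a + d) - mean nu i a <= d%:R * gamma nu i a.
Proof.
move=> a0; elim: d => [|d IH]; first by rewrite addn0 subrr mul0r.
have := gamma_le d a0; rewrite {1}/gamma addnS -natr1 mulrDl mul1r.
by move: IH; lra.
Qed.

Lemma mean_diff_ge a d : (0 < a)%N ->
  d%:R * gamma nu i (a + d) <= mean nu i (a + d) - mean nu i a.
Proof.
move=> a0; elim: d => [|d IH]; first by rewrite addn0 subrr mul0r.
have g1 : gamma nu i (a + d).+1 <= gamma nu i (a + d) by apply: nuR.2; lia.
have : d%:R * gamma nu i (a + d).+1 <= d%:R * gamma nu i (a + d) by rewrite ler_wpM2l.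
move: g1; rewrite addnS -natr1 mulrDl mul1r {2}/gamma.
by move: IH; lra.
Qed.

Lemma mean_le a b : (0 < a)%N -> (a <= b)%N -> mean nu i a <= mean nu i b.
Proof.
move=> a0 /subnKC <-; rewrite -subr_ge0; apply: le_trans (mean_diff_ge _ a0).
by rewrite mulr_ge0// gamma_ge0//; lia.
Qed.

End RisingMeans.

(** * Optimism and bias of the noiseless estimator *)

Section RoundRegret.
Context {R : realType} {k : nat}.
Variables (nu : environment R k) (G : 'M[bool]_k.+1).
Variables (sigma : R) (delta : nat -> R) (eps : R) (h : seq (obs R k)).
Hypotheses (nuR : rising nu) (Gd : forall i, G i i) (eps01 : 0 <= eps < 1 / 2).

Let n i l := trigger_at G i (arms h) l.

Let n_gt0 i l : (0 < l <= pulls i (arms h))%N -> (0 < n i l)%N.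
Proof. by move=> lN; have := trigger_at_ge (Gd i) lN; rewrite -/(n _ _); lia. Qed.

Let n_lt i l : (n i l < round h)%N.
Proof.
rewrite ltnS -size_arms; apply: leq_trans (trigger_at_le _ _ _ _) _.
exact: triggers_le_size.
Qed.

Let n_dist i a b : (0 < a <= b)%N -> (b <= pulls i (arms h))%N ->
  (n i a + (b - a) <= n i b)%N.
Proof.
move=> /andP[a0 ab] bN; rewrite -[in X in (_ <= X)%N](subnKC ab).
by apply: trigger_at_dist; rewrite ?subnKC.
Qed.

(** Each summand already dominates the mean. At least [w] triggers separate the pulls [l - w] and
    [l], so by concavity the slope per pull is at least the increment [g] at pull [l]; and [g]
    bounds every later increment, of which at most [round h - l] remain. *)
Lemma mu_tilde_optimistic j w : (0 < w)%N -> (w + w <= pulls j (arms h))%N ->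
  mean nu j (round h) <= mu_tilde nu G h j w.
Proof.
move=> w0 wN; rewrite /mu_tilde; set N := pulls j (arms h) in wN *.
have w0' : 0 < w%:R :> R by rewrite ltr0n.
rewrite -(ler_pM2l w0') mulrA mulfV ?gt_eqF// mul1r.
apply: (@le_trans _ _ (\sum_((N - w).+1 <= l < N.+1) mean nu j (round h))).
  by rewrite sumr_const_nat mulr_natl (_ : (_ - _)%N = w)//; lia.
apply: ler_sum_nat => l /andP[Nl lN].
have l0N : (0 < l <= N)%N by lia.
rewrite -!/(n j _); set g := gamma nu j (n j l).
have g0 : 0 <= g by apply: gamma_ge0 => //; exact: n_gt0.
have ln : (l <= n j l)%N by apply: trigger_at_ge.
have H1 : mean nu j (round h) - mean nu j (n j l) <= ((round h)%:R - (n j l)%:R) * g.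
  have := mean_diff_le j nuR (round h - n j l) (n_gt0 l0N).
  rewrite subnKC ?natrB//; exact/ltnW/n_lt.
have dist : (n j (l - w) + (l - (l - w)) <= n j l)%N by apply: n_dist; lia.
have H2 : g <= (mean nu j (n j l) - mean nu j (n j (l - w))) / w%:R.
  rewrite ler_pdivlMr// mulrC.
  have n0 : (0 < n j (l - w))%N by apply: n_gt0; rewrite -/N; lia.
  have := mean_diff_ge j nuR (n j l - n j (l - w)) n0.
  rewrite subnKC; last by lia.
  apply: le_trans; rewrite ler_wpM2r// ler_nat; lia.
have H3 : ((round h)%:R - (n j l)%:R) * g <= ((round h)%:R - l%:R) * g.
  by rewrite ler_wpM2r// lerB// ler_nat.
have : ((round h)%:R - l%:R) * g <= ((round h)%:R - l%:R) *
    ((mean nu j (n j l) - mean nu j (n j (l - w))) / w%:R).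
  by rewrite ler_wpM2l// subr_ge0 ler_nat; apply: leq_trans ln (ltnW (n_lt _ _)).
by lra.
Qed.

(** Means at past pulls are below the present one, so only the slopes contribute. All the pulls
    involved come from pull [M] on, where the trigger count is at least [M]; hence a difference of
    means is at most [round h] increments, each at most [gamma nu i M]. *)
Lemma mu_tilde_bias i w : (0 < w)%N -> (w + w <= pulls i (arms h))%N ->
  mu_tilde nu G h i w - mean nu i (triggers G i (rcons (arms h) i)) <=
  (round h)%:R ^+ 2 * gamma nu i (pulls i (arms h) - w - w).+1 / w%:R.
Proof.
move=> w0 wN; rewrite /mu_tilde; set N := pulls i (arms h) in wN *.
set M := (N - w - w).+1.
have w0' : 0 < w%:R :> R by rewrite ltr0n.
rewrite lerBlDr -(ler_pM2l w0') mulrA mulfV ?gt_eqF// mul1r.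
set tr := triggers G i _; set c := (X in _ <= _ * X).
apply: (@le_trans _ _ (\sum_((N - w).+1 <= l < N.+1) c)); last first.
  by rewrite sumr_const_nat [leRHS]mulr_natl (_ : (_ - _)%N = w)//; lia.
apply: ler_sum_nat => l /andP[Nl lN].
have l0N : (0 < l <= N)%N by lia.
rewrite -!/(n i _) /c addrC; apply: lerD; last first.
  apply: mean_le => //; first exact: n_gt0.
  by rewrite ltnW// /tr triggers_rcons Gd addn1 ltnS trigger_at_le.
rewrite mulrA ler_pM2r ?invr_gt0//.
have M0 : (0 < M)%N by [].
have nM : (0 < n i M)%N by apply: n_gt0; rewrite -/N /M; lia.
have MnM : (M <= n i M)%N by apply: trigger_at_ge; rewrite // -/N /M; lia.
have Ml : (n i M <= n i (l - w))%N.
  by have := @n_dist i M (l - w)%N; rewrite -/N /M; lia.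
have lw : (n i (l - w) <= n i l)%N by have := @n_dist i (l - w)%N l; rewrite -/N; lia.
have H : mean nu i (n i l) - mean nu i (n i (l - w)) <= (round h)%:R * gamma nu i M.
  have h1 := mean_le i nuR nM Ml.
  have h2 : mean nu i (n i l) - mean nu i (n i M) <=
      (n i l - n i M)%:R * gamma nu i (n i M).
    by have := mean_diff_le i nuR (n i l - n i M) nM; rewrite subnKC//; lia.
  have h3 : (n i l - n i M)%:R * gamma nu i (n i M) <= (round h)%:R * gamma nu i M.
    apply: ler_pM => //; first exact: gamma_ge0.
      by rewrite ler_nat; have := n_lt i l; lia.
    by rewrite -(subnKC MnM); exact: gamma_le.
  by lra.
have D0 : 0 <= mean nu i (n i l) - mean nu i (n i (l - w)).
  by rewrite subr_ge0; apply: mean_le => //; apply: leq_trans nM Ml.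
rewrite expr2 -mulrA; apply: ler_pM => //; last by rewrite lerBlDr lerDl.
rewrite subr_ge0 ler_nat; have := trigger_at_ge (Gd i) l0N.
by have := n_lt i l; rewrite -/(n _ _); lia.
Qed.

(** The chain is: mean of [j], noiseless estimate of [j], index of [j], index of [i], noiseless
    estimate of [i] plus twice [beta]. *)
Lemma round_regret i j : ~~ misestimated nu G sigma delta eps h ->
  (forall j, (ucb_index sigma delta eps h j <= ucb_index sigma delta eps h i)%E) ->
  window eps h i != 0%N ->
  let w := window eps h i in
  mean nu j (round h) - mean nu i (triggers G i (rcons (arms h) i)) <=
  (round h)%:R ^+ 2 * gamma nu i (pulls i (arms h) - w - w).+1 / w%:R
  + 2 * beta sigma delta h i w.
Proof.
move=> /existsPn good amax wi; cbv zeta; set w := window eps h i.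
have est l : window eps h l != 0%N ->
    `|mu_hat h l (window eps h l) - mu_tilde nu G h l (window eps h l)|
      <= beta sigma delta h l (window eps h l).
  by move=> wl; have := good l; rewrite /= wl /= -leNgt.
(* An empty window would give [j] an infinite index, above the finite one of the maximiser [i]. *)
have wj : window eps h j != 0%N.
  apply/eqP => wj; have := amax j; rewrite /ucb_index wj eqxx (negbTE wi).
  by rewrite leye_eq.
have := amax j; rewrite /ucb_index (negbTE wi) (negbTE wj) lee_fin -/w => le.
have := est _ wi; have := est _ wj; rewrite !ler_norml -/w => /andP[j1 j2] /andP[i1 i2].
have := mu_tilde_optimistic (j := j) (w := window eps h j).
rewrite lt0n window_double// => /(_ wj isT) oj.
have := mu_tilde_bias (i := i) (w := w).
rewrite lt0n window_double// => /(_ wi isT) bi.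
by lra.
Qed.

End RoundRegret.

(** * Real inequalities *)

Section RealInequalities.
Context {R : realType}.
Implicit Types (x y q : R).

Lemma ln_natr_ge0 n : 0 <= ln n%:R :> R.
Proof. by case: n => [|n]; [rewrite ln0|rewrite ln_ge0// ler1n]. Qed.

Lemma harmonic_sum_le L : \sum_(1 <= n < L.+1) n%:R^-1 <= 1 + ln L%:R :> R.
Proof.
elim: L => [|[|L] IH]; first by rewrite big_geq// ln0// addr0.
  by rewrite big_nat1 invr1 ln1 addr0.
rewrite big_nat_recr//=; apply: (@le_trans _ _ (1 + ln L.+1%:R + L.+2%:R^-1)).
  by rewrite lerD2r.
rewrite -addrA lerD2l.
(* Factoring lets [ln (1 + x) <= x] at [x = - 1 / (L + 2)] show that the logarithm grows by at least
   the new term. *)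
have -> : L.+1%:R = L.+2%:R * (1 + - L.+2%:R^-1) :> R.
  by rewrite mulrDr mulr1 mulrN mulfV// -[in X in X - 1]natr1 addrK.
have L1 : L.+2%:R^-1 < 1 :> R by rewrite invf_lt1 ?ltr1n.
rewrite lnM ?posrE ?subr_gt0// -addrA gerDl.
have := @le_ln1Dx R (- L.+2%:R^-1); rewrite ltrN2 L1 => /(_ isT).
by move=> H; rewrite -lerBrDr sub0r.
Qed.

(** A number below 1 only grows under an exponent in [0, 1], while one above 1 keeps a power above 1
    and dominates [I] alone. Bias and confidence width can thus receive different exponents. *)
Lemma le_powR_split (I x y r s : R) : 0 <= x -> 0 <= y -> 0 <= r <= 1 -> 0 <= s <= 1 ->
  I <= 1 -> I <= x + y -> I <= x `^ r + y `^ s.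
Proof.
have pow z p : 0 <= z -> 0 <= p <= 1 -> z < 1 -> z <= z `^ p.
  rewrite le_eqVlt => /orP[/eqP<- _ _|z0 /andP[_ p1] z1]; first exact: powR_ge0.
  by apply: ger1_powR => //; rewrite z0 ltW.
have pow1 z p : 0 <= p <= 1 -> 1 <= z -> 1 <= z `^ p.
  by move=> /andP[p0 _] z1; rewrite -(powRr0 z) ler_powR.
move=> x0 y0 r01 s01 I1 Ixy.
have [x1|x1] := ltP x 1; last first.
  by apply: le_trans I1 _; rewrite -[1]addr0 lerD ?powR_ge0 ?pow1.
have [y1|y1] := ltP y 1; last first.
  by apply: le_trans I1 _; rewrite -[1]add0r lerD ?powR_ge0 ?pow1.
by apply: le_trans Ixy _; rewrite lerD ?pow.
Qed.

(* The exponents [q / (1 + q)] and [1 / (1 + q)] add up to one, so that the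
   two powers of [1 / N] combine. *)
Lemma bias_term (T g Gam eps q rd w N M : R) : 0 < eps -> eps < 1 / 2 ->
  0 <= q <= 1 -> 0 <= rd <= T -> 0 < w -> 0 < N -> eps * N <= 2 * w ->
  (1 - 2 * eps) * N <= M -> 0 <= g -> g `^ q <= Gam / M ->
  (rd ^+ 2 * g / w) `^ (q / (1 + q)) <=
  2 / eps / (1 - 2 * eps) * T `^ (2 * q / (1 + q)) * Gam `^ (1 / (1 + q)) / N.
Proof.
move=> e0 e1 /andP[q0 q1] /andP[rd0 rdT] w0 N0 ewN eMN g0 gq.
have d0 : 0 < 1 - 2 * eps by lra.
have M0 : 0 < M by apply: lt_le_trans eMN; rewrite mulr_gt0.
have Gam0 : 0 <= Gam.
  by have := le_trans (powR_ge0 _ _) gq; rewrite pmulr_lge0// invr_gt0.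
have T0 : 0 <= T by apply: le_trans rdT.
have q1' : 0 < 1 + q by lra.
set r := q / (1 + q); set s := 1 / (1 + q).
have rs : r + s = 1 by rewrite /r /s -mulrDl addrC mulfV// gt_eqF.
have r0 : 0 <= r by rewrite divr_ge0// ltW.
have s0 : 0 <= s by rewrite divr_ge0// ltW.
have r1 : r <= 1 by lra.
have s1 : s <= 1 by lra.
have rE : r = q * s by rewrite /r /s; field; rewrite gt_eqF.
apply: (@le_trans _ _ ((T ^+ 2 * (2 / eps * N^-1) * g) `^ r)).
  apply: ge0_ler_powR => //; rewrite ?nnegrE.
  - by rewrite divr_ge0 ?mulr_ge0 ?exprn_ge0// ltW.
  - by rewrite !mulr_ge0 ?exprn_ge0 ?invr_ge0// ltW.
  - rewrite mulrAC ler_wpM2r//; apply: ler_pM => //.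
    + by rewrite exprn_ge0.
    + by rewrite invr_ge0 ltW.
    + by rewrite lerXn2r ?nnegrE.
    + have -> : 2 / eps * N^-1 = (eps * N / 2)^-1 by field; rewrite !gt_eqF.
      by rewrite lef_pV2 ?posrE ?divr_gt0 ?mulr_gt0//; lra.
have gr : g `^ r <= (1 / (1 - 2 * eps)) * Gam `^ s * N^-1 `^ s.
  rewrite rE powRrM; apply: (@le_trans _ _ ((1 / (1 - 2 * eps) * Gam * N^-1) `^ s)).
    apply: ge0_ler_powR => //; rewrite ?nnegrE ?powR_ge0//.
      by rewrite !mulr_ge0 ?invr_ge0// ltW.
    apply: le_trans gq _; rewrite div1r mulrAC [leRHS]mulrC ler_wpM2l//.
    by rewrite -invfM lef_pV2 ?posrE ?mulr_gt0.
  (* A constant at least 1 bounds its own power of exponent at most 1; [2 / eps] is treated alike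
     below. *)
  have a1 : 1 <= 1 / (1 - 2 * eps) by rewrite div1r invf_ge1//; lra.
  move: (1 / (1 - 2 * eps)) a1 => a a1.
  have a0 : 0 <= a by lra.
  rewrite !powRM ?mulr_ge0 ?invr_ge0 ?(ltW N0)// -!mulrA.
  by apply: ler_wpM2r; [rewrite mulr_ge0 ?powR_ge0|exact: ler1_powR].
have T2 : (T ^+ 2) `^ r = T `^ (2 * q / (1 + q)).
  by rewrite -powR_mulrn// -powRrM mulrA.
have e2 : (2 / eps) `^ r <= 2 / eps.
  by apply: ler1_powR => //; rewrite ler_pdivlMr//; lra.
have f0 : 0 <= 2 / eps by rewrite divr_ge0// ltW.
have Ni0 : 0 <= N^-1 by rewrite invr_ge0 ltW.
have T20 : 0 <= T ^+ 2 by rewrite exprn_ge0.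
move: (T ^+ 2) (2 / eps) T20 T2 e2 f0 => u v u0 T2 e2 v0.
rewrite (powRM _ (mulr_ge0 u0 (mulr_ge0 v0 Ni0)) g0) (powRM _ u0 (mulr_ge0 v0 Ni0)).
rewrite (powRM _ v0 Ni0) T2.
apply: (@le_trans _ _ (T `^ (2 * q / (1 + q)) * (v * N^-1 `^ r) *
   (1 / (1 - 2 * eps) * Gam `^ s * N^-1 `^ s))).
  apply: ler_pM => //; rewrite ?mulr_ge0 ?powR_ge0//.
  by rewrite ler_wpM2l ?powR_ge0// ler_wpM2r ?powR_ge0.
have NN : N^-1 = N^-1 `^ r * N^-1 `^ s.
  by rewrite -powRD ?rs ?powRr1 ?invr_ge0 ?(ltW N0)// oner_eq0.
rewrite [X in _ <= _ * X]NN le_eqVlt; apply/orP; left; apply/eqP.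
by rewrite div1r; ring.
Qed.

(** The width decays like [N] to the power -3/2, which the exponent 2/3 turns into [1 / N]. *)
Lemma beta_term (T sigma alpha eps rd N w D : R) : 0 < eps -> eps < 1 / 2 -> 2 < alpha ->
  0 <= sigma -> 1 <= rd <= T -> 0 < w -> 0 < N -> eps * N <= 2 * w ->
  0 <= D <= T ->
  (2 * (sigma * D * Num.sqrt (10 * ln (1 / (rd `^ (- alpha))) / w ^+ 3))) `^ (2 / 3)
  <= 320 * alpha / eps * (1 + ln T) * (sigma * T) `^ (2 / 3) / N.
Proof.
move=> e0 e1 a2 s0 /andP[rd1 rdT] w0 N0 ewN /andP[D0 DT].
have T1 : 1 <= T by apply: le_trans rdT.
have T0 : 0 <= T by lra.
have lnT : 0 <= ln T by rewrite ln_ge0.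
have lnrd : ln rd <= ln T by rewrite ler_ln ?posrE//; lra.
have lnrd0 : 0 <= ln rd by rewrite ln_ge0.
have eN : 0 < eps * N by rewrite mulr_gt0.
have -> : ln (1 / (rd `^ (- alpha))) = alpha * ln rd.
  by rewrite powRN div1r invrK ln_powR.
(* 320 is 4 * 10 * 8: the square of the leading 2 moved under the root, the 10 of [beta], and the
   cube of the 2 in [eps * N <= 2 * w]. *)
set z := 320 * alpha * (1 + ln T).
have z1 : 1 <= z.
  rewrite /z; have : 1 * 1 <= 320 * alpha * (1 + ln T) by apply: ler_pM; lra.
  by rewrite mulr1.
have le1 : 10 * (alpha * ln rd) / w ^+ 3 <= z / 4 / (eps * N) ^+ 3.
  rewrite ler_pdivrMr ?exprn_gt0// mulrAC ler_pdivlMr ?exprn_gt0//.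
  have c3 : (eps * N) ^+ 3 <= 8 * w ^+ 3.
    rewrite (_ : 8 * w ^+ 3 = (2 * w) ^+ 3); last by ring.
    by apply: lerXn2r; rewrite ?nnegrE ?mulr_ge0//; lra.
  apply: (@le_trans _ _ (10 * (alpha * ln rd) * (8 * w ^+ 3))).
    by rewrite ler_wpM2l// !mulr_ge0//; lra.
  rewrite mulrA ler_wpM2r ?exprn_ge0 ?(ltW w0)// /z.
  rewrite (_ : 320 * alpha * (1 + ln T) / 4 = 80 * alpha * (1 + ln T)); last by field.
  rewrite (_ : 10 * (alpha * ln rd) * 8 = 80 * alpha * ln rd); last by ring.
  by rewrite ler_wpM2l//; lra.
have sT0 : 0 <= sigma * T by rewrite mulr_ge0.
have u0 : 0 <= 10 * (alpha * ln rd) / w ^+ 3.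
  by rewrite divr_ge0 ?exprn_ge0 ?(ltW w0)// !mulr_ge0//; lra.
have le2 : 2 * (sigma * D * Num.sqrt (10 * (alpha * ln rd) / w ^+ 3)) <=
    sigma * T * Num.sqrt (z * (eps * N)^-1 ^+ 3).
  have -> : z * (eps * N)^-1 ^+ 3 = 2 ^+ 2 * (z / 4 / (eps * N) ^+ 3).
    by field; rewrite !gt_eqF.
  rewrite [X in _ <= _ * X]sqrtrM ?sqr_ge0// sqrtr_sqr ger0_norm// [leRHS]mulrCA ler_wpM2l//.
  apply: ler_pM; rewrite ?mulr_ge0 ?sqrtr_ge0 ?ler_wpM2l//.
  by rewrite ler_wsqrtr.
apply: (@le_trans _ _ ((sigma * T * Num.sqrt (z * (eps * N)^-1 ^+ 3)) `^ (2 / 3))).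
  apply: ge0_ler_powR => //; rewrite ?nnegrE ?mulr_ge0 ?sqrtr_ge0//.
have z0 : 0 <= z by lra.
have i0 : 0 <= (eps * N)^-1 by rewrite invr_ge0 ltW.
have i30 := exprn_ge0 3 i0.
rewrite (powRM _ sT0 (sqrtr_ge0 _)) -(powR12_sqrt (mulr_ge0 z0 i30)).
rewrite -powRrM (_ : 2^-1 * (2 / 3) = 3^-1); last by field.
rewrite (powRM _ z0 i30) -(powR_mulrn _ i0) -powRrM mulfV ?powRr1//.
have -> : 320 * alpha / eps * (1 + ln T) * (sigma * T) `^ (2 / 3) / N =
    (sigma * T) `^ (2 / 3) * (z * (eps * N)^-1).
  by rewrite /z; field; rewrite !gt_eqF.
rewrite ler_wpM2l ?powR_ge0// ler_wpM2r//.
by apply: ler1_powR => //; lra.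
Qed.

(** Each of the [b] consecutive blocks of length [M] is termwise below the first one. *)
Lemma sum_antitone_le (g : nat -> R) (b M : nat) :
  (forall m d, g (m + d)%N <= g m) ->
  \sum_(0 <= m < b * M) g m <= b%:R * \sum_(0 <= m < M) g m.
Proof.
move=> gd; elim: b => [|b IH]; first by rewrite mul0n big_geq// mul0r.
rewrite mulSn addnC (@big_cat_nat _ _ _ (b * M))//= ?leq_addr//.
rewrite -natr1 mulrDl mul1r lerD//.
rewrite -{1}[(b * M)%N]add0n big_addn addKn.
by apply: ler_sum => m _; exact: gd.
Qed.

End RealInequalities.

(** * The largest increments and their sums *)

Section GammaMax.
Context {R : realType} {k : nat} (nu : environment R k) (q : R).
Hypotheses (nuR : rising nu) (q0 : 0 <= q).

Definition gamma_max (n : nat) : R := \big[Num.max/0]_(i < k.+1) gamma nu i n `^ q.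

Lemma gamma_max_ge0 n : 0 <= gamma_max n.
Proof. exact: bigmax_ge_id. Qed.

Lemma gamma_max_ge i n : gamma nu i n `^ q <= gamma_max n.
Proof. by rewrite /gamma_max; exact: (le_bigmax _ (fun i => gamma nu i n `^ q) i). Qed.

Lemma gamma_max_le n d : (0 < n)%N -> gamma_max (n + d) <= gamma_max n.
Proof.
move=> n0; apply: le_bigmax2 => i _; apply: ge0_ler_powR => //; rewrite ?nnegrE.
- by apply: gamma_ge0 => //; lia.
- exact: gamma_ge0.
- exact: gamma_le.
Qed.

(** This is [Upsilon nu T.+1 q]. *)
Definition total_increment (T : nat) : R := \sum_(1 <= n < T.+1) gamma_max n.

Lemma total_increment_ge0 T : 0 <= total_increment T.
Proof. by apply: sumr_ge0 => n _; exact: gamma_max_ge0. Qed.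

(** By monotonicity, the [n]-th term is at most the average of the first [n]. *)
Lemma gamma_max_le_div T n : (0 < n <= T)%N ->
  gamma_max n <= total_increment T / n%:R.
Proof.
move=> /andP[n0 nT]; rewrite ler_pdivlMr ?ltr0n// /total_increment.
rewrite (@big_cat_nat _ _ _ n.+1)//=.
apply: (@le_trans _ _ (\sum_(1 <= m < n.+1) gamma_max m)); last first.
  by rewrite lerDl; apply: sumr_ge0 => m _; exact: gamma_max_ge0.
apply: (@le_trans _ _ (\sum_(1 <= m < n.+1) gamma_max n)).
  by rewrite sumr_const_nat subn1 mulr_natr.
by apply: ler_sum_nat => m /andP[m0 mn]; rewrite -(subnKC (_ : m <= n)%N)// gamma_max_le.
Qed.

(* As [gamma_max] decreases, the first [T] maxima weigh at most [b] times the
   first [ceil (T / b)] ones; [Upsilon] misses the last of these, whence the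
   factor 2. *)
Lemma total_increment_le T b : (0 < b < T)%N ->
  total_increment T <= 2 * b%:R * Upsilon nu (@ceil_div R T b) q.
Proof.
move=> /andP[b0 bT]; set M := ceil_div T b.
have b0' : 0 < b%:R :> R by rewrite ltr0n.
have Tb : 1 < T%:R / b%:R :> R by rewrite ltr_pdivlMr// mul1r ltr_nat.
have cM : M%:R = (Num.ceil (T%:R / b%:R : R))%:~R :> R.
  rewrite /M /ceil_div natr_absz ger0_norm//.
  by rewrite ceil_ge0; lra.
have TM : T%:R / b%:R <= M%:R :> R by rewrite cM ceil_ge.
have TbM : (T <= b * M)%N by rewrite -(ler_nat R) natrM mulrC -ler_pdivrMr.
have M2 : (1 < M)%N by rewrite -(ltr_nat R); apply: lt_le_trans TM.
have UE : Upsilon nu M q = \sum_(1 <= n < M) gamma_max n by [].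
(* As [M] is at least 2, the sum [Upsilon nu M q] is not empty and contains [gamma_max 1]. *)
have gM : gamma_max M <= Upsilon nu M q.
  rewrite UE big_ltn//; apply: (@le_trans _ _ (gamma_max 1)).
    by rewrite -(subnKC (ltnW M2)) gamma_max_le.
  by rewrite lerDl; apply: sumr_ge0 => m _; exact: gamma_max_ge0.
rewrite /total_increment big_add1 /=.
apply: (@le_trans _ _ (\sum_(0 <= n < b * M) gamma_max n.+1)).
  rewrite (@big_cat_nat _ _ _ T 0 (b * M))//= lerDl.
  by apply: sumr_ge0 => m _; exact: gamma_max_ge0.
apply: (le_trans (sum_antitone_le (g := fun n => gamma_max n.+1) b M _)).
  by move=> m d; rewrite -addSn gamma_max_le.
have -> : \sum_(0 <= n < M) gamma_max n.+1 = Upsilon nu M q + gamma_max M.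
  transitivity (\sum_(1 <= n < M.+1) gamma_max n); first by rewrite [RHS]big_add1.
  by rewrite big_nat_recr// ltnW.
by rewrite [2 * _]mulrC -mulrA ler_wpM2l//; lra.
Qed.

End GammaMax.

(** * Cost of a controlled round *)

Section RoundBound.
Context {R : realType} {k : nat}.
Variables (nu : environment R k) (G : 'M[bool]_k.+1).
Variables (sigma alpha eps q : R) (T : nat).
Hypotheses (nuR : rising nu) (nuU : means_in_unit nu) (Gd : forall i, G i i).
Hypotheses (s0 : 0 <= sigma) (e0 : 0 < eps) (e1 : eps < 1 / 2) (a2 : 2 < alpha).
Hypothesis (q01 : 0 <= q <= 1).

Let delta (t : nat) : R := t%:R `^ (- alpha).

(* [pull_cost / N] bounds the regret of a controlled round in which the arm played
   has been pulled [N] times; the term [eps^-1] accounts for empty windows. *)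
Definition pull_cost : R :=
  eps^-1 + 2 / eps / (1 - 2 * eps) * T%:R `^ (2 * q / (1 + q)) *
    total_increment nu q T `^ (1 / (1 + q))
  + 320 * alpha / eps * (1 + ln T%:R) * (sigma * T%:R) `^ (2 / 3).

Let c1_ge0 : 0 <= 2 / eps / (1 - 2 * eps).
Proof.
have d0 : 0 <= 1 - 2 * eps by move: e1; lra.
by apply: divr_ge0 => //; apply: divr_ge0 => //; exact: ltW.
Qed.

Lemma round_bound (h : seq (obs R k)) i j : (size h < T)%N ->
  ~~ misestimated nu G sigma delta eps h ->
  (forall j, (ucb_index sigma delta eps h j <= ucb_index sigma delta eps h i)%E) ->
  let N := pulls i (arms h) in
  mean nu j (round h) - mean nu i (triggers G i (rcons (arms h) i)) <=
  (N == 0%N)%:R + pull_cost / N%:R.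
Proof.
move=> hT good amax; cbv zeta; set N := pulls i (arms h); have [he0 he1 ha2] := And3 e0 e1 a2.
have /andP[q0 q1] := q01.
have tr0 : (0 < triggers G i (rcons (arms h) i))%N by rewrite triggers_rcons Gd addn1.
have le1 : mean nu j (round h) - mean nu i (triggers G i (rcons (arms h) i)) <= 1.
  have /andP[_ A] := nuU j (isT : 0 < round h)%N.
  have /andP[B _] := nuU i tr0.
  by lra.
have T0 : 1 <= T%:R :> R by rewrite ler1n (leq_ltn_trans _ hT).
have lnT0 : 0 <= ln T%:R :> R by rewrite ln_ge0.
have A0 : 0 <= 2 / eps / (1 - 2 * eps) * T%:R `^ (2 * q / (1 + q)) *
    total_increment nu q T `^ (1 / (1 + q)).
  by apply: mulr_ge0; [apply: mulr_ge0|]; rewrite ?c1_ge0 ?powR_ge0.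
have B0 : 0 <= 320 * alpha / eps * (1 + ln T%:R) * (sigma * T%:R) `^ (2 / 3).
  apply: mulr_ge0; last exact: powR_ge0.
  by apply: mulr_ge0; [apply: divr_ge0; [lra|exact: ltW]|lra].
(* Division by 0 gives 0, so a first pull is charged 1 by the indicator alone. *)
have [N0|N0] := eqVneq N 0%N.
  by rewrite N0 invr0 mulr0 addr0.
have N0' : 0 < N%:R :> R by rewrite ltr0n lt0n.
rewrite add0r.
have [w0|w0] := eqVneq (window eps h i) 0%N.
  apply: (le_trans le1); rewrite ler_pdivlMr// mul1r /pull_cost -addrA.
  have : eps * N%:R < 1.
    by have := truncnS_gt (eps * N%:R); rewrite -/(window eps h i) w0.
  move=> eN; have : N%:R <= eps^-1.
    by rewrite -[eps^-1]mul1r ler_pdivlMr// mulrC ltW.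
  by lra.
have eps01 : 0 <= eps < 1 / 2 by rewrite ltW.
have := round_regret nuR Gd eps01 j good amax w0.
cbv zeta; set w := window eps h i in w0 *; rewrite -/N => reg.
have wN : (w + w <= N)%N by exact: window_double.
have w1 : 1 <= w%:R :> R by rewrite ler1n lt0n.
(* The floor loses less than 1 and [w] is at least 1. The converse bound [weN] keeps [N - w - w] at
   least [(1 - 2 * eps) * N]. *)
have ewN : eps * N%:R <= 2 * w%:R.
  have := truncnS_gt (eps * N%:R); rewrite -/(window eps h i) -/w -natr1.
  by lra.
have weN : w%:R <= eps * N%:R by rewrite /w /window truncn_le mulr_ge0// ltW.
have Nh : N%:R <= (size h)%:R :> R by rewrite ler_nat -size_arms count_size.
have rdE : (round h)%:R = (size h)%:R + 1 :> R by rewrite natr1.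
have rdT : (round h)%:R <= T%:R :> R by rewrite ler_nat.
have rd1 : 1 <= (round h)%:R :> R by rewrite ler1n.
have wNR : w%:R + w%:R <= N%:R :> R by rewrite -natrD ler_nat.
set g := gamma nu i (N - w - w).+1 in reg.
have g0 : 0 <= g by exact: gamma_ge0.
have b0 : 0 <= beta sigma delta h i w.
  rewrite /beta mulr_ge0 ?sqrtr_ge0// mulr_ge0// -/N; lra.
have q2 : 0 < 1 + q by lra.
have x0 : 0 <= (round h)%:R ^+ 2 * g / w%:R by rewrite !mulr_ge0 ?invr_ge0.
have y0 : 0 <= 2 * beta sigma delta h i w by rewrite mulr_ge0.
have r01 : 0 <= q / (1 + q) <= 1.
  rewrite divr_ge0 ?(ltW q2)//=.
  by rewrite ler_pdivrMr//; lra.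
have s01 : 0 <= (2 / 3 : R) <= 1.
  by rewrite divr_ge0//= ler_pdivrMr// mul1r ler_nat.
have {}reg := le_powR_split x0 y0 r01 s01 le1 reg.
have NT : (N <= size h)%N by rewrite -size_arms count_size.
have M1 : ((N - w - w).+1 <= T)%N.
  exact: leq_ltn_trans (leq_trans (leq_subr _ _) (leq_trans (leq_subr _ _) NT)) hT.
have H1 : ((round h)%:R ^+ 2 * g / w%:R) `^ (q / (1 + q)) <=
     2 / eps / (1 - 2 * eps) * T%:R `^ (2 * q / (1 + q)) *
     total_increment nu q T `^ (1 / (1 + q)) / N%:R.
  apply: (@bias_term R T%:R g _ eps q _ _ _ (N - w - w).+1%:R) => //.
  - by rewrite rdT andbT (le_trans ler01).
  - exact: lt_le_trans w1.
  - by rewrite -[leRHS]natr1 -subnDA natrB// natrD; lra.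
  - apply: le_trans (gamma_max_le_div nuR q0 _); last by rewrite M1.
    exact: gamma_max_ge.
have H2 : (2 * beta sigma delta h i w) `^ (2 / 3) <=
    320 * alpha / eps * (1 + ln T%:R) * (sigma * T%:R) `^ (2 / 3) / N%:R.
  apply: (@beta_term R _ _ _ eps) => //.
  - by rewrite rd1.
  - exact: lt_le_trans w1.
  - by apply/andP; split; rewrite -/N; lra.
apply: le_trans reg _; apply: le_trans (lerD H1 H2) _.
by rewrite -mulrDl ler_wpM2r ?invr_ge0// /pull_cost -addrA lerDr invr_ge0 ltW.
Qed.

End RoundBound.

(** * Summation over the rounds *)

Section Failures.
Context {R : realType} {k : nat}.
Variables (nu : environment R k) (G : 'M[bool]_k.+1).
Variables (sigma : R) (delta : nat -> R) (eps : R).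
Implicit Types (h : seq (obs R k)) (i : 'I_k.+1).

Definition index_maximiser h i : bool :=
  [forall j, (ucb_index sigma delta eps h j <= ucb_index sigma delta eps h i)%E].

(* An upper bound of the indicator of the rounds whose regret is not controlled. *)
Definition failure h i : R :=
  (misestimated nu G sigma delta eps h)%:R + (~~ index_maximiser h i)%:R.

Definition failures h : R :=
  \sum_(t < size h) failure (take t h) (nth ord0 (arms h) t).

Lemma failure_ge0 h i : 0 <= failure h i.
Proof. by rewrite addr_ge0. Qed.

Lemma failures_ge0 h : 0 <= failures h.
Proof. by apply: sumr_ge0 => t _; exact: failure_ge0. Qed.

Lemma failures_rcons h z : failures (rcons h z) = failures h + failure h z.1.
Proof.
rewrite /failures size_rcons big_ord_recr /= arms_rcons nth_rcons size_arms.
have -> : take (size h) (rcons h z) = h by rewrite -cats1 take_size_cat.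
rewrite ltnn eqxx; congr (_ + _).
apply: eq_bigr => t _.
by rewrite nth_rcons size_arms ltn_ord -cats1 takel_cat// ltnW.
Qed.

Hypothesis (eps01 : 0 <= eps < 1 / 2).

Let real_index h i : R :=
  mu_hat h i (window eps h i) + beta sigma delta h i (window eps h i).

Let measurable_real_index t i :
  measurable_fun [set: t.-tuple (obs R k)] (fun h : t.-tuple (obs R k) => real_index h i).
Proof.
pose W (s : seq 'I_k.+1) := Num.truncn (eps * (pulls i s)%:R).
pose g (s : t.-tuple 'I_k.+1) (h : t.-tuple (obs R k)) : R :=
  (W s)%:R^-1 * \sum_((pulls i s - W s).+1 <= l < (pulls i s).+1)
    (pull_reward h i l
     + (t.+1%:R - l%:R) * ((pull_reward h i l - pull_reward h i (l - W s)) / (W s)%:R))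
  + sigma * (t.+1%:R - (pulls i s)%:R + (W s)%:R - 1)
  * Num.sqrt (10 * ln (1 / delta t.+1) / (W s)%:R ^+ 3).
apply: (@measurable_arms_piecewise R k t _ _ _ g) => [s|h]; last first.
  by rewrite /real_index /mu_hat /beta /window /round size_tuple.
apply: measurable_funD; last exact: measurable_cst.
apply: measurable_funM; first exact: measurable_cst.
apply: measurable_sum => l; apply: measurable_funD; first exact: measurable_pull_reward.
apply: measurable_funM; first exact: measurable_cst.
apply: measurable_funM; last exact: measurable_cst.
by apply: measurable_funB; exact: measurable_pull_reward.
Qed.

Lemma measurable_index_maximiser t i :
  measurable_fun [set: t.-tuple (obs R k)]
    (fun h : t.-tuple (obs R k) => index_maximiser h i).
Proof.
(* An index is infinite exactly when the window is empty; this expresses that [j] beats [i] through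
   real-valued indices only. *)
pose b j (h : t.-tuple (obs R k)) := ~~ ((window eps h i == 0%N) ||
  ((window eps h j != 0%N) && (real_index h j <= real_index h i))).
have mb j : measurable_fun [set: _] (b j).
  apply: measurable_neg; apply: measurable_or.
    exact: (@measurable_of_arms R k t _ _
      (fun s => Num.truncn (eps * (pulls i s)%:R) == 0%N)).
  apply: measurable_and.
    exact: (@measurable_of_arms R k t _ _
      (fun s => Num.truncn (eps * (pulls j s)%:R) != 0%N)).
  by apply: measurable_fun_ler; exact: measurable_real_index.
rewrite (_ : (fun _ => _) = (fun h : t.-tuple (obs R k) => ~~ [exists j, b j h])).
  exact/measurable_neg/measurable_exists.
apply/funext => h; rewrite negb_exists; apply: eq_forallb => j.
rewrite negbK /ucb_index.
case: (window eps h i == 0%N); case: (window eps h j == 0%N) => //=.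
by rewrite ?leey ?leye_eq ?lee_fin.
Qed.

Lemma measurable_natr_bool d (T : measurableType d) (b : T -> bool) :
  measurable_fun [set: T] b -> measurable_fun [set: T] (fun x => (b x)%:R : R).
Proof. by move=> mb; apply: (measurableT_comp (f := fun b : bool => b%:R : R)). Qed.

Lemma measurable_failures (subg : subgaussian sigma nu) (s0 : 0 <= sigma)
    (Gd : forall i, G i i) t :
  measurable_fun [set: t.-tuple (obs R k)] (fun h : t.-tuple (obs R k) => failures h).
Proof.
pose pre (s : 'I_t) (h : t.-tuple (obs R k)) : s.-tuple (obs R k) :=
  [tuple tnth h (widen_ord (ltnW (ltn_ord s)) j) | j < s].
have preE s (h : t.-tuple (obs R k)) : pre s h = take s h :> seq _.
  apply: (@eq_from_nth _ (ord0, 0)); first by rewrite size_tuple size_take size_tuple ltn_ord.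
  move=> j; rewrite size_tuple => js; rewrite nth_take//.
  rewrite -(tnth_nth _ _ (Ordinal js)) tnth_mktuple (tnth_nth (ord0, 0)).
  by [].
have mpre s : measurable_fun [set: _] (pre s).
  apply/measurable_fun_tnthP => j.
  rewrite (_ : _ \o _ = (fun h : t.-tuple (obs R k) =>
      tnth h (widen_ord (ltnW (ltn_ord s)) j))).
    exact: measurable_tnth.
  by apply/funext => h /=; rewrite tnth_mktuple.
(* The arm played varies with the history, so its failure to maximise is written as a finite
   disjunction over its possible values. *)
rewrite (_ : (fun _ => _) = (fun h : t.-tuple (obs R k) => \sum_(s < t)
   ((misestimated nu G sigma delta eps (pre s h))%:R +
    ([exists i, (nth ord0 (arms h) s == i) && ~~ index_maximiser (pre s h) i])%:R))).
  apply: measurable_sum => s; apply: measurable_funD; apply: measurable_natr_bool.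
    apply: (measurableT_comp (f := fun h : s.-tuple (obs R k) =>
      misestimated nu G sigma delta eps h)); last exact: mpre.
    exact: measurable_misestimated.
  refine (@measurable_exists _ (t.-tuple (obs R k)) _ (fun i (h : t.-tuple (obs R k)) =>
    (nth ord0 (arms h) s == i) && ~~ index_maximiser (pre s h) i) _) => i.
  apply: measurable_and.
    exact: (@measurable_of_arms R k t _ _ (fun u => nth ord0 u s == i)).
  apply: measurable_neg; apply: (measurableT_comp (f := fun h : s.-tuple (obs R k) =>
      index_maximiser h i)); last exact: mpre.
  exact: measurable_index_maximiser.
apply/funext => h; rewrite /failures size_tuple; apply: eq_bigr => s _.
rewrite /failure preE; congr (_ + _%:R); congr (nat_of_bool _).
apply/idP/existsP => [nm|[i /andP[/eqP -> //]]].
by exists (nth ord0 (arms h) s); rewrite eqxx.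
Qed.

End Failures.

Section ExpectedFailures.
Context {R : realType} {k : nat}.
Variables (nu : environment R k) (G : 'M[bool]_k.+1).
Variables (sigma : R) (delta : nat -> R) (eps : R) (T : nat) (pol : policy R k).
Hypotheses (eps01 : 0 <= eps < 1 / 2) (subg : subgaussian sigma nu) (s0 : 0 <= sigma).
Hypotheses (Gd : forall i, G i i) (delta01 : forall s, (0 < s)%N -> 0 < delta s <= 1).
Hypothesis (ucb : R_square_UCB sigma delta eps T pol).

Let fails (h : seq (obs R k)) : R := failures nu G sigma delta eps h.
Let mis (h : seq (obs R k)) : R := (misestimated nu G sigma delta eps h)%:R.

(** Misestimation is decided before the arm is drawn, and the policy gives no mass to arms that do
    not maximise the index. *)
Let integral_pol t (h : t.-tuple (obs R k)) : (t < T)%N ->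
  (\int[pol t h]_j (failure nu G sigma delta eps h j)%:E = (mis h)%:E)%E.
Proof.
move=> tT; pose A := [set j | index_maximiser sigma delta eps h j].
have A1 : pol t h A = 1%E.
  rewrite -(ucb h tT); congr (pol t h _); apply/seteqP; split=> j /=.
    by move/forallP.
  by move=> H; apply/forallP.
have AC : pol t h (~` A) = 0%E.
  have : (pol t h A + pol t h (~` A) = 1)%E.
    by rewrite -measureU// ?setICr// setUv; exact: prob_kernel.
  rewrite A1 => H; have := congr1 (fun x => x - 1)%E H.
  by rewrite addeAC subee// add0e.
rewrite (eq_integral (fun j => (cst (mis h)%:E j + (\1_(~` A) j)%:E)%E)) => [|j _].
  rewrite ge0_integralD//=; last by move=> j _; rewrite lee_fin.
  by rewrite integral_cst// prob_kernel mule1 integral_indic// setIT AC adde0.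
rewrite -EFinD /failure; congr (_ + _)%:E; rewrite indicE; congr (nat_of_bool _)%:R.
rewrite in_setC; congr (~~ _).
by apply/idP/idP => [H|/set_mem//]; exact: mem_set.
Qed.

Lemma integral_failures t : (t <= T)%N ->
  (\int[trajectory_law nu G pol t]_h (fails h)%:E <=
   (\sum_(s < t) 2 * k.+1%:R * s.+1%:R * delta s.+1)%:E)%E.
Proof.
have ge0 t' (h : t'.-tuple (obs R k)) : (0 <= (fails h)%:E)%E.
  by rewrite lee_fin failures_ge0.
have mF t' : measurable_fun [set: t'.-tuple (obs R k)]
    (fun h : t'.-tuple (obs R k) => (fails h)%:E).
  by apply/measurable_EFinP; exact: measurable_failures.
elim: t => [_|t IH tT] /=.
  have e0 : fails ([tuple] : 0.-tuple (obs R k)) = 0 by rewrite /fails /failures big_ord0.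
  rewrite integral_dirac; [|exact: measurableT|exact: mF].
  by rewrite e0 mule0 big_ord0.
rewrite integral_extend//.
rewrite (eq_integral (fun h : t.-tuple (obs R k) => ((fails h)%:E + (mis h)%:E)%E)) => [|h _].
  have mm : measurable_fun [set: t.-tuple (obs R k)]
      (fun h : t.-tuple (obs R k) => (mis h)%:E).
    by apply/measurable_EFinP/measurable_natr_bool; exact: measurable_misestimated.
  rewrite ge0_integralD//; [|exact: mF|by move=> h _; rewrite lee_fin].
  rewrite big_ord_recr /= EFinD; apply: leeD; first exact/IH/ltnW.
  apply: le_trans (prob_misestimated pol subg Gd s0 eps01 (delta01 (ltn0Sn t))).
  rewrite le_eqVlt; apply/orP; left; apply/eqP.
  pose A := [set h : t.-tuple (obs R k) | misestimated nu G sigma delta eps h].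
  have mA : measurable A by apply: measurable_bool_set; exact: measurable_misestimated.
  transitivity (\int[trajectory_law nu G pol t]_h (\1_A h)%:E)%E.
    apply: eq_integral => h _; rewrite indicE /mis; congr (nat_of_bool _)%:R%:E.
    by apply/idP/idP => [H|/set_mem//]; exact: mem_set.
  by rewrite integral_indic// setIT.
transitivity (\int[pol t h]_j
    (cst (fails h)%:E j + (failure nu G sigma delta eps h j)%:E))%E.
  apply: eq_integral => j _.
  rewrite (eq_integral (cst ((fails h)%:E + (failure nu G sigma delta eps h j)%:E)%E)).
    rewrite integral_cst// [X in (_ * X)%E](_ : _ = 1%E) ?mule1//.
    exact: probability_setT.
  by move=> x _; rewrite /fails /= failures_rcons EFinD.
rewrite ge0_integralD//; [|by move=> j _; exact: ge0|
  by move=> j _; rewrite lee_fin failure_ge0].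
by rewrite integral_cst// prob_kernel mule1 integral_pol.
Qed.

End ExpectedFailures.

(** * Regret along a trajectory *)

Section Pathwise.
Context {R : realType} {k : nat}.
Variables (nu : environment R k) (G : 'M[bool]_k.+1).
Variables (sigma alpha eps q : R) (T : nat).
Hypotheses (nuR : rising nu) (nuU : means_in_unit nu) (Gd : forall i, G i i).
Hypotheses (s0 : 0 <= sigma) (e0 : 0 < eps) (e1 : eps < 1 / 2) (a2 : 2 < alpha).
Hypothesis (q01 : 0 <= q <= 1).

Let delta (t : nat) : R := t%:R `^ (- alpha).

(** For [n] at least 1 the means are nonnegative, so the default 0 of the maximum is harmless. *)
Definition best_mean (n : nat) : R := \big[Num.max/0]_(i < k.+1) mean nu i n.

Lemma best_mean_ge i n : mean nu i n <= best_mean n.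
Proof. exact: (le_bigmax _ (fun i => mean nu i n) i). Qed.

Lemma best_mean_le1 n : (0 < n)%N -> best_mean n <= 1.
Proof.
by move=> n0; apply: bigmax_le => // i _; case/andP: (nuU i n0).
Qed.

Let K := pull_cost nu sigma alpha eps q T.
Let psi (N : nat) : R := (N == 0%N)%:R + K / N%:R.

Lemma pull_cost_ge0 : 0 <= pull_cost nu sigma alpha eps q T.
Proof.
have d0 : 0 <= 1 - 2 * eps by move: e1; lra.
have al : 0 <= 320 * alpha by move: a2; lra.
have lnT : 0 <= 1 + ln T%:R :> R.
  by rewrite addr_ge0// ln_natr_ge0.
apply: addr_ge0; first (apply: addr_ge0; first by rewrite invr_ge0 ltW).
  apply: mulr_ge0; last exact: powR_ge0.
  apply: mulr_ge0; last exact: powR_ge0.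
  by apply: divr_ge0 => //; apply: divr_ge0 => //; exact: ltW.
apply: mulr_ge0; last exact: powR_ge0.
apply: mulr_ge0; last exact: lnT.
by apply: divr_ge0; [exact: al|exact: ltW].
Qed.

Let psi_ge0 N : 0 <= psi N.
Proof. by rewrite addr_ge0// divr_ge0// pull_cost_ge0. Qed.

Let sum_psi L : (L <= T)%N -> \sum_(N < L) psi N <= 1 + K * (1 + ln T%:R).
Proof.
have lnT : 0 <= 1 + ln T%:R :> R.
  by rewrite addr_ge0// ln_natr_ge0.
have K0 := pull_cost_ge0; rewrite -/K in K0.
case: L => [_|L LT]; first by rewrite big_ord0 addr_ge0// mulr_ge0.
rewrite -(big_mkord xpredT psi) big_ltn// {1}/psi eqxx invr0 mulr0 addr0 lerD2l.
rewrite (eq_big_nat _ _ (F2 := fun N => K * N%:R^-1)); last first.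
  by move=> N /andP[N0 _]; rewrite /psi gtn_eqF// add0r.
rewrite -mulr_sumr ler_wpM2l//; apply: le_trans (harmonic_sum_le L) _.
rewrite lerD2l; case: L LT => [|L] LT.
  by rewrite ln0// ln_ge0// ler1n.
by rewrite ler_ln ?posrE ?ltr0n ?ler_nat//; apply: leq_trans LT.
Qed.

(** A round loses at most 1, which [failure] absorbs when it is positive; otherwise [round_bound]
    applies. Grouping the rounds by arm leaves [k.+1] harmonic sums. *)
Lemma pathwise_regret (w : T.-tuple (obs R k)) :
  \sum_(t < T) best_mean t.+1 <= total_mean nu G w
    + k.+1%:R * (1 + K * (1 + ln T%:R)) + failures nu G sigma delta eps w.
Proof.
set s := arms w; have sT : size s = T by rewrite size_arms size_tuple.
apply: (@le_trans _ _ (total_mean nu G w +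
   \sum_(t < T) psi (pulls (nth ord0 s t) (take t s)) +
   failures nu G sigma delta eps w)); last first.
  rewrite lerD2r lerD2l.
  have := sum_pulls (fun _ => psi) s; rewrite sT => ->.
  rewrite -[X in X%:R](card_ord k.+1) mulr_natl -sumr_const.
  by apply: ler_sum => i _; apply: sum_psi; rewrite -sT count_size.
rewrite /total_mean /failures size_tuple -!big_split/=; apply: ler_sum => t _.
have ts : (t < size s)%N by rewrite sT.
have -> : (tnth w t).1 = nth ord0 s t.
  by rewrite (tnth_nth (ord0, 0)) /s /arms (nth_map (ord0, 0)) ?size_tuple.
set i := nth ord0 s t; set h := take t w.
have hs : arms h = take t s by rewrite /h /s /arms map_take.
have sh : size h = t by rewrite size_take size_tuple ltn_ord.
have ti : take t.+1 s = rcons (arms h) i by rewrite (take_nth ord0 ts) hs.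
have m01 : 0 <= mean nu i (triggers G i (take t.+1 s)).
  have tr0 : (0 < triggers G i (take t.+1 s))%N.
    by rewrite ti triggers_rcons Gd addn1.
  by case/andP: (nuU i tr0).
have ps := psi_ge0 (pulls i (take t s)).
rewrite {1}/failure.
have [bad|good] := boolP (misestimated nu G sigma delta eps h).
  apply: (le_trans (best_mean_le1 (ltn0Sn t))).
  have : 0 <= (~~ index_maximiser sigma delta eps h i)%:R :> R by [].
  by move: m01 ps => /=; lra.
have [ismax|nomax] := boolP (index_maximiser sigma delta eps h i); last first.
  apply: (le_trans (best_mean_le1 (ltn0Sn t))).
  by move: m01 ps => /=; lra.
rewrite /= !addr0; apply: bigmax_le; first by rewrite addr_ge0.
move=> j _.
have := round_bound (T := T) nuR nuU Gd s0 e0 e1 a2 q01 (h := h) (i := i) j.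
rewrite sh => /(_ (ltn_ord t) good); move/forallP: ismax => ismax /(_ ismax).
by rewrite /round sh -ti hs -/(psi _) lerBlDl addrC.
Qed.

End Pathwise.

(** * From trajectories to the expected regret *)

Section Regret.
Context {R : realType} {k : nat}.
Variables (nu : environment R k) (G : 'M[bool]_k.+1) (T : nat).
Hypotheses (nuR : rising nu) (nuU : means_in_unit nu) (Gd : forall i, G i i).

Definition best_total : R := \sum_(t < T) best_mean nu t.+1.

(** By a given round an arm has at most as many triggers as rounds, and means rise; hence the bound
    for every policy. *)
Lemma total_mean_bounds (w : T.-tuple (obs R k)) :
  0 <= total_mean nu G w <= best_total.
Proof.
have tr0 (t : 'I_T) : (0 < triggers G (tnth w t).1 (take t.+1 (arms w)))%N.
  have tw : (t < size (arms w))%N by rewrite size_arms size_tuple.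
  rewrite (take_nth ord0 tw) triggers_rcons (tnth_nth (ord0, 0)).
  by rewrite (nth_map (ord0, 0)) ?size_tuple// Gd addn1.
apply/andP; split.
  by apply: sumr_ge0 => t _; case/andP: (nuU (tnth w t).1 (tr0 t)).
apply: ler_sum => t _ /=; apply: le_trans (best_mean_ge nu (tnth w t).1 _).
apply: mean_le => //; apply: leq_trans (triggers_le_size _ _ _) _.
by rewrite size_take; case: ltnP.
Qed.

Lemma measurable_total_mean :
  measurable_fun [set: T.-tuple (obs R k)] (fun w => (total_mean nu G w)%:E).
Proof.
apply/measurable_EFinP; rewrite [X in measurable_fun _ X](_ : _ = (fun w : T.-tuple (obs R k) =>
  (fun s => \sum_(t < T) mean nu (nth ord0 s t)
     (triggers G (nth ord0 s t) (take t.+1 s))) (arms w))).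
  exact: (@measurable_of_arms R k T _ _ (fun s => \sum_(t < T) mean nu (nth ord0 s t)
     (triggers G (nth ord0 s t) (take t.+1 s)))).
apply/funext => w; apply: eq_bigr => t _ /=.
by rewrite (tnth_nth (ord0, 0)) (nth_map (ord0, 0)) ?size_tuple.
Qed.

Lemma performance_bounds pol :
  (0 <= performance nu G T pol <= best_total%:E)%E.
Proof.
rewrite /performance expectation.unlock; apply/andP; split.
  by apply: integral_ge0 => w _; rewrite lee_fin; case/andP: (total_mean_bounds w).
have -> : (best_total%:E =
    \int[trajectory_law nu G pol T]_w (cst best_total%:E) w)%E.
  by rewrite integral_cst// [X in (_ * X)%E](_ : _ = 1%E) ?mule1//; exact: probability_setT.
apply: ge0_le_integral => //.
- by move=> w _; rewrite lee_fin; case/andP: (total_mean_bounds w).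
- exact: measurable_total_mean.
- by move=> w _; rewrite lee_fin; case/andP: (total_mean_bounds w).
Qed.

Lemma performance_fin_num pol : performance nu G T pol \is a fin_num.
Proof.
have /andP[p0 p1] := performance_bounds pol.
by rewrite ge0_fin_numE//; apply: le_lt_trans p1 (ltry _).
Qed.

Lemma regret_le pol :
  (regret nu G T pol <= (best_total - fine (performance nu G T pol))%:E)%E.
Proof.
rewrite EFinB fineK ?performance_fin_num// /regret leeB//.
by apply: ge_ereal_sup => _ [pol' _ <-]; case/andP: (performance_bounds pol').
Qed.

Lemma best_total_le (pol : policy R k) (D P : R) (f : T.-tuple (obs R k) -> R) :
  0 <= D -> (forall w, 0 <= f w) -> measurable_fun [set: _] (fun w => (f w)%:E) ->
  (forall w, best_total <= total_mean nu G w + D + f w) ->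
  (\int[trajectory_law nu G pol T]_w (f w)%:E <= P%:E)%E ->
  best_total - fine (performance nu G T pol) <= D + P.
Proof.
move=> D0 f0 mf le fP.
have tm0 (w : T.-tuple (obs R k)) : 0 <= total_mean nu G w by case/andP: (total_mean_bounds w).
rewrite lerBlDl -lee_fin EFinD fineK ?performance_fin_num// EFinD.
have icst (x : R) : (\int[trajectory_law nu G pol T]_w (cst x%:E) w = x%:E)%E.
  by rewrite integral_cst// [X in (_ * X)%E](_ : _ = 1%E) ?mule1//; exact: probability_setT.
have e2 : (\int[trajectory_law nu G pol T]_w (total_mean nu G w)%:E =
    performance nu G T pol)%E by rewrite /performance expectation.unlock.
rewrite addeA; apply: (@le_trans _ _ (\int[trajectory_law nu G pol T]_w
    ((total_mean nu G w)%:E + cst D%:E w + (f w)%:E))%E).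
  rewrite -[leLHS]icst; apply: ge0_le_integral => //.
  - by move=> w _; apply: le_trans (_ : (0%:E <= (best_total)%:E)%E); rewrite // lee_fin;
      apply: sumr_ge0 => t _; exact: bigmax_ge_id.
  - apply: emeasurable_funD => //; apply: emeasurable_funD => //.
    exact: measurable_total_mean.
  - by move=> w _; rewrite -!EFinD lee_fin.
rewrite ge0_integralD//; first last.
- by move=> w _; rewrite lee_fin.
- by apply: emeasurable_funD => //; exact: measurable_total_mean.
- by move=> w _; rewrite -EFinD lee_fin addr_ge0.
rewrite ge0_integralD//; first last.
- exact: measurable_total_mean.
- by move=> w _; rewrite lee_fin.
by rewrite e2 icst leeD2l.
Qed.

End Regret.

(** * Comparison with the rate *)

Section Rate.
Context {R : realType} {k : nat}.
Variables (nu : environment R k) (G : 'M[bool]_k.+1) (C : {set {set 'I_k.+1}}).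
Variables (sigma alpha eps : R) (T : nat).
Hypotheses (nuR : rising nu) (nuU : means_in_unit nu) (Gd : forall i, G i i).
Hypotheses (s0 : 0 <= sigma) (e0 : 0 < eps) (e1 : eps < 1 / 2) (a2 : 2 < alpha).
Hypothesis (partC : finset.partition C [set: 'I_k.+1]%SET).

Let slack : R := 2 / eps / (1 - 2 * eps).

(** For each arm, the 3 collects 1 for its first pull and 2 for its share of the misestimations; the
    rest are the constants of [pull_cost]. *)
Definition regret_const : R :=
  k.+1%:R * (3 + (eps^-1 + 2 * slack + 320 * alpha / eps)).

Let ei0 : 0 <= eps^-1.
Proof. by rewrite invr_ge0 ltW. Qed.

Let sl0 : 0 <= slack.
Proof.
have d0 : 0 <= 1 - 2 * eps by move: e1; lra.
by apply: divr_ge0 => //; apply: divr_ge0 => //; exact: ltW.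
Qed.

Let al0 : 0 <= 320 * alpha / eps.
Proof.
have al : 0 <= 320 * alpha by move: a2; lra.
by apply: divr_ge0; [exact: al|exact: ltW].
Qed.

Let log0 : 0 <= ln T%:R :> R.
Proof. exact: ln_natr_ge0. Qed.

Let Upsilon_ge0 M q : 0 <= Upsilon nu M q.
Proof. by apply: sumr_ge0 => n _; exact: bigmax_ge_id. Qed.

Lemma rate_ge0 q : 0 <= rate nu G C sigma T q.
Proof.
rewrite /rate; apply: addr_ge0; first (apply: addr_ge0; first exact: powR_ge0).
  by apply: mulr_ge0; [apply: mulr_ge0; [exact: powR_ge0|]|exact: Upsilon_ge0].
apply: mulr_ge0; first exact: powR_ge0.
by apply: sumr_ge0 => B _; apply: mulr_ge0; [|exact: powR_ge0].
Qed.

Lemma rate_ge B q : B \in C ->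
  (sigma * T%:R) `^ (2 / 3) + T%:R `^ (2 * q / (1 + q)) *
    (#|B|%:R * Upsilon nu (@ceil_div R T #|B|) q `^ (1 / (1 + q)))
  <= rate nu G C sigma T q.
Proof.
move=> BC; rewrite /rate; apply: lerD.
  rewrite lerDl; apply: mulr_ge0; last exact: Upsilon_ge0.
  by apply: mulr_ge0; first exact: powR_ge0.
apply: ler_wpM2l; first exact: powR_ge0.
rewrite (bigD1 B)//= lerDl; apply: sumr_ge0 => B' _.
by apply: mulr_ge0; [|exact: powR_ge0].
Qed.

Lemma pull_cost_le q : 0 <= q <= 1 -> (k.+1 < T)%N ->
  pull_cost nu sigma alpha eps q T <=
  (eps^-1 + 2 * slack + 320 * alpha / eps) *
    ((1 + ln T%:R) * (1 + rate nu G C sigma T q)).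
Proof.
move=> /andP[q0 q1] kT.
(* Any clique will do; the one containing arm 0 is nonempty and, having at most [k.+1] arms, smaller
   than [T]. *)
have [B BC B0] : exists2 B, B \in C & ord0 \in B.
  have : ord0 \in finset.cover C by rewrite (cover_partition partC) finset.in_setT.
  by move=> /bigcupP[B BC B0]; exists B.
have b0 : (0 < #|B|)%N by apply/card_gt0P; exists ord0.
have bT : (#|B| < T)%N.
  by apply: leq_ltn_trans kT; rewrite -[X in (_ <= X)%N](card_ord k.+1) max_card.
have rB := rate_ge q BC.
have bb : (0 < #|B| < T)%N by rewrite b0.
have TI := total_increment_le nuR q0 bb.
set U := Upsilon nu _ q in rB TI; set b : R := #|B|%:R in rB TI.
have U0 : 0 <= U by exact: Upsilon_ge0.
have b1 : 1 <= b by rewrite ler1n.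
have q2 : 0 < 1 + q by lra.
have sle1 : 0 <= 1 / (1 + q) <= 1.
  apply/andP; split; first by apply: divr_ge0 => //; exact: ltW.
  by rewrite ler_pdivrMr//; lra.
set s := 1 / (1 + q) in rB sle1; have /andP[sg0 sg1] := sle1.
have TIs : total_increment nu q T `^ s <= 2 * b * U `^ s.
  apply: (@le_trans _ _ ((2 * b * U) `^ s)).
    apply: ge0_ler_powR => //; rewrite ?nnegrE ?total_increment_ge0//.
    by apply: mulr_ge0 => //; apply: mulr_ge0.
  rewrite powRM//; last by apply: mulr_ge0.
  apply: ler_wpM2r; first exact: powR_ge0.
  by apply: ler1_powR => //; move: b1; lra.
have := rate_ge0 q; set r := rate _ _ _ _ _ _ in rB * => r0.
set X := T%:R `^ _ in rB; have X0 : 0 <= X by exact: powR_ge0.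
set Y := (sigma * T%:R) `^ _ in rB; have Y0 : 0 <= Y by exact: powR_ge0.
rewrite /pull_cost -/slack -/X -/Y -/s; move: log0; set L := ln _ => L0.
have bU0 : 0 <= b * U `^ s by apply: mulr_ge0 => //; exact: powR_ge0.
have XU0 : 0 <= X * (b * U `^ s) by apply: mulr_ge0.
have XU : X * total_increment nu q T `^ s <= 2 * r.
  apply: (@le_trans _ _ (X * (2 * b * U `^ s))); first exact: ler_wpM2l.
  by move: rB Y0; rewrite -[2 * b * _]mulrA mulrCA; lra.
have Yr : Y <= r by move: rB XU0; lra.
have Lr0 : 0 <= L * r by apply: mulr_ge0.
rewrite (_ : (1 + L) * (1 + r) = 1 + L + r + L * r); last by ring.
rewrite (mulrDl (eps^-1 + 2 * slack)) (mulrDl eps^-1).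
apply: lerD; first apply: lerD.
- by rewrite -[leLHS]mulr1; apply: ler_wpM2l => //; lra.
- rewrite -[leLHS]mulrA [2 * slack]mulrC -[leRHS]mulrA; apply: ler_wpM2l => //.
  by move: XU; lra.
- rewrite -[leLHS]mulrA; apply: ler_wpM2l => //.
  rewrite (_ : 1 + L + r + L * r = (1 + L) * (1 + r)); last by ring.
  by apply: ler_wpM2l; lra.
Qed.

Lemma ucb_regret (pol : policy R k) q : subgaussian sigma nu -> 0 <= q <= 1 ->
  R_square_UCB sigma (fun t => t%:R `^ (- alpha)) eps T pol ->
  best_total nu T - fine (performance nu G T pol) <=
  regret_const * (1 + ln T%:R) ^+ 2 * (1 + rate nu G C sigma T q).
Proof.
move=> subg q01 ucb.
set delta := fun t : nat => t%:R `^ (- alpha) : R.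
have r0 := rate_ge0 q.
set Kc := eps^-1 + 2 * slack + 320 * alpha / eps.
have Kc0 : 0 <= Kc by apply: addr_ge0 => //; apply: addr_ge0 => //; apply: mulr_ge0.
set l := 1 + ln T%:R; have l1 : 1 <= l by rewrite lerDl.
set Q := 1 + rate _ _ _ _ _ _; have Q1 : 1 <= Q by rewrite lerDl.
have l21 : 1 <= l ^+ 2 by rewrite exprn_ege1.
have lQ1 : 1 <= l ^+ 2 * Q by rewrite mulr_ege1.
rewrite (_ : _ * Q = k.+1%:R * ((3 + Kc) * (l ^+ 2 * Q))); last first.
  by rewrite /regret_const -/Kc; ring.
(* For [T] at most [k.+1] a clique may have [T] arms or more, and its [Upsilon] is then an empty
   sum; but the regret is at most [T], hence at most [k.+1]. *)
have [kT|kT] := ltnP k.+1 T; last first.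
  apply: (@le_trans _ _ k.+1%:R).
    rewrite lerBlDr; apply: (@le_trans _ _ T%:R).
      apply: (@le_trans _ _ (\sum_(t < T) 1)).
        by apply: ler_sum => t _; exact: best_mean_le1.
      by rewrite sumr_const card_ord.
    rewrite -[leLHS]addr0; apply: lerD; first by rewrite ler_nat.
    by apply: fine_ge0; case/andP: (performance_bounds T nuR nuU Gd pol).
  rewrite -[leLHS]mulr1; apply: ler_wpM2l => //; apply: mulr_ege1 => //.
  by move: Kc0; lra.
have K := pull_cost_le q01 kT; rewrite -/Kc -/l -/Q in K.
have eps01 : 0 <= eps < 1 / 2 by rewrite ltW.
have delta01 t : (0 < t)%N -> 0 < delta t <= 1.
  move=> t0; rewrite powR_gt0 ?ltr0n//= -(powRr0 t%:R).
  by apply: ler_powR; [rewrite ler1n|move: a2; lra].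
(* As [alpha] exceeds 2, the product of [t] and [delta t] is at most [1 / t]: again a harmonic
   sum. *)
have P : \sum_(t < T) 2 * k.+1%:R * t.+1%:R * delta t.+1 <= k.+1%:R * (2 * l) :> R.
  apply: (@le_trans _ _ (\sum_(t < T) 2 * k.+1%:R * t.+1%:R^-1)).
    apply: ler_sum => t _; rewrite -[leLHS]mulrA; apply: ler_wpM2l; first exact: mulr_ge0.
    apply: (@le_trans _ _ (t.+1%:R * t.+1%:R `^ (- 2))).
      apply: ler_wpM2l => //; apply: ler_powR; first by rewrite ler1n.
      by move: a2; lra.
    by rewrite powR_invn// expr2 invfM mulrA mulfV ?mul1r.
  rewrite -mulr_sumr [2 * _]mulrC -mulrA; apply: ler_wpM2l => //; apply: ler_wpM2l => //.
  have := @harmonic_sum_le R T; rewrite big_add1 /= big_mkord.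
  exact.
apply: (@le_trans _ _ (k.+1%:R * (1 + pull_cost nu sigma alpha eps q T * l) +
    k.+1%:R * (2 * l))).
  apply: (best_total_le nuR nuU Gd (f := fun h : T.-tuple (obs R k) =>
      failures nu G sigma delta eps h)) => //.
  - apply: mulr_ge0 => //; apply: addr_ge0 => //; apply: mulr_ge0; last by move: l1; lra.
    exact: pull_cost_ge0.
  - by move=> w; exact: failures_ge0.
  - by apply/measurable_EFinP; exact: measurable_failures.
  - move=> w; exact: pathwise_regret.
  - apply: le_trans (integral_failures eps01 subg s0 Gd delta01 ucb (leqnn T)) _.
    by rewrite lee_fin.
rewrite -mulrDr; apply: ler_wpM2l => //.
have Kl : pull_cost nu sigma alpha eps q T * l <= Kc * (l ^+ 2 * Q).
  rewrite (_ : Kc * (l ^+ 2 * Q) = Kc * (l * Q) * l); last by ring.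
  by apply: ler_wpM2r => //; move: l1; lra.
have ll : l <= l ^+ 2 * Q.
  rewrite expr2 -mulrA -[leLHS]mulr1; apply: ler_wpM2l; first by move: l1; lra.
  exact: mulr_ege1.
rewrite (mulrDl 3 Kc).
by move: Kl ll lQ1; lra.
Qed.

End Rate.

Theorem theorem7 (R : realType) :
  exists p : R, 0 <= p /\
  forall (k : nat) (eps alpha : R),
    0 < eps -> eps < 1 / 2 -> 2 < alpha ->
  exists c : R,
  forall (T : nat) (sigma : R) (nu : environment R k)
      (G GU : 'M[bool]_k.+1) (C : {set {set 'I_k.+1}}) (pol : policy R k),
    0 <= sigma ->
    connectivity G ->
    means_in_unit nu ->
    subgaussian sigma nu ->
    rising nu ->
    minimal_block_supermatrix G GU C ->
    R_square_UCB sigma (fun t => t%:R `^ (- alpha)) eps T pol ->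
    (regret nu G T pol
      <= (c * (1 + ln T%:R) `^ p * (1 + best_rate nu G C sigma T))%:E)%E.
Proof.
(* The exponent 2 counts two logarithms, one from the confidence width and one from the harmonic
   sums. *)
exists 2; split=> // k eps alpha e0 e1 a2; exists (@regret_const R k alpha eps).
move=> T sigma nu G GU C pol s0 [_ Gd] nuU subg nuR [[[partC _] _] _] ucb.
apply: (le_trans (regret_le T nuR nuU Gd pol)); rewrite lee_fin.
have l1 : 1 <= 1 + ln T%:R :> R.
  by rewrite lerDl ln_natr_ge0.
rewrite powR_mulrn; last by move: l1; lra.
set c := _ * _ ^+ 2.
have c0 : 0 < c.
  apply: mulr_gt0; last by rewrite exprn_gt0//; move: l1; lra.
  have d0 : 0 < 1 - 2 * eps by lra.
  have f1 : 0 < 2 / eps / (1 - 2 * eps) by apply: divr_gt0 => //; exact: divr_gt0.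
  have al : 0 < 320 * alpha by lra.
  have f2 : 0 < 320 * alpha / eps by apply: divr_gt0; [exact: al|exact: e0].
  have f3 : 0 < eps^-1 by rewrite invr_gt0.
  by apply: mulr_gt0; [exact: ltr0Sn|move: f1 f2 f3; lra].
(* Isolating the infimum by dividing by [c] reduces the claim to one bound for each [q], with the
   same constant. *)
rewrite mulrC -ler_pdivrMr// -lerBlDl; apply: lb_le_inf.
  by exists (rate nu G C sigma T 0); exists 0 => //=; rewrite lexx ler01.
move=> _ [q q01 <-]; rewrite lerBlDl ler_pdivrMr// mulrC.
exact: ucb_regret.
Qed.
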